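(* Let $(\mathcal X,f)$ be a dynamical system with invariant probability measure $\mu=\mathbb P$, let $\zeta$ be a periodic point of prime period $p$, and let $(\hat{\mathcal X},\hat f)$ be a first return system as in the context. If the induced system satisfies conditions (M1), (M2), (S1), (S2), and if the limit $$\hat H(J,\kappa)=\lim_{u\to u_F}\hat\mu\big(\{\hat{\mathscr N}_u(\hat vJ)\le\kappa\}\big),\qquad J\in\mathcal S,\ \kappa\in\mathbb N_0,$$ exists, with $\hat H(J,\cdot)$ the distribution function of an integer valued random variable, and is continuous in the sense that $\lim_{\delta\to0}\hat H((1\pm\delta)J,\kappa)=\hat H(J,\kappa)$ for every $\kappa$, then for each $J\in\mathcal R$ there exist $\delta_J(u)>0$ (defined for $u<u_F$) such that $\delta_J(u)\searrow0$ as $u\nearrow u_F$ and, for all $\kappa\in\mathbb N_0$, $$\big|\mathbb P(\{\mathscr N_u(vJ)\le\kappa\})-\hat H(J,\kappa)\big|<\delta_J(u).$$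
   Context: Setting. $\mathcal X$ is a smooth Riemannian manifold, $f:\mathcal X\to\mathcal X$ is Borel measurable, $\mu=\mathbb P$ is an $f$-invariant probability measure. The observable $\varphi:\mathcal X\to[-\infty,\infty]$ has a global maximum at $\zeta$, $u_F=\varphi(\zeta)$, $U(u)=\{\varphi>u\}$, $X_n=\varphi\circ f^n$. $\hat{\mathcal X}\subset\mathcal X$ is a subset containing $\zeta$, $R_{\hat{\mathcal X}}$ is the first return time to $\hat{\mathcal X}$, $\hat f=f^{R_{\hat{\mathcal X}}}$ is the first return map, and $\hat{\mathcal X}$ is assumed so small that $R_{\hat{\mathcal X}}(\zeta)=p$ (so $\zeta$ is a fixed point of $\hat f$). $\hat\mu(B)=\mu(B\cap\hat{\mathcal X})/\mu(\hat{\mathcal X})$, which is $\hat f$-invariant. $\hat X_n=\varphi\circ\hat f^n$. $\mathcal S$ is the set of intervals $[a,b)\subset\mathbb R_0^+$ and $\mathcal R$ is the ring of finite unions of such intervals. The function $\hat H$ is introduced for $J\in\mathcal S$; for $J\in\mathcal R$, $\hat H(J,\kappa)$ is understood as the same limit. For $A\subset\mathbb R$, $\mathscr N_u(A)=\sum_{i\in A\cap\mathbb N_0}\mathbf 1_{X_i>u}$ and $\hat{\mathscr N}_u(A)=\sum_{i\in A\cap\mathbb N_0}\mathbf 1_{\hat X_i>u}$; $v=1/\mathbb P(U(u))$, $\hat v=1/\mathbb P(U(u)\mid\hat{\mathcal X})=1/\hat\mu(U(u))$. A potential $\phi:\mathcal X\to\mathbb R$ is given, with induced potential $\hat\phi(x)=\sum_{i=0}^{R_{\hat{\mathcal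 X}}(x)-1}\phi(f^ix)$ on $\hat{\mathcal X}$. The pressure of a potential is $P(\phi)=\sup\{h(\nu)+\int\phi\,d\nu:\nu\text{ invariant probability},-\int\phi\,d\nu<\infty\}$, with $h(\nu)$ the metric entropy; an equilibrium state is an invariant probability attaining it; a measure $m$ is $\phi$-conformal if it has total mass $1$ and $m(f(A))=\int_Ae^{-\phi}dm$ whenever $A$ is Borel and $f:A\to f(A)$ is a bijection. For the induced system $(\hat{\mathcal X},\hat f,\hat\phi)$ the conditions read: (M1) $P(\hat\phi)=0$. (M2) There are a finite $\hat\phi$-conformal measure $m$ and a constant $C>0$ such that the equilibrium state is $\hat\mu=\rho m$ with density $\rho:\hat{\mathcal X}\to[1/C,C]$. (S1) For each $\varepsilon_0\in(0,1)$ there exists $u_0<u_F$ such that $U(u)$ is a topological ball for any $u\in[u_0-\varepsilon_0,u_F)$ and such that for each $u\in(u_0,u_F)$ there exist $n=n(u_0,u)\in\mathbb N$ and $\varepsilon\in(0,\varepsilon_0)$ with $U(u_0+\varepsilon)\subset\hat f^{n}(U(u))\subset U(u_0-\varepsilon)$. (S2) For some $\delta>0$, $\hat f|_{B_\delta(\zeta)}$ is a bijection onto its image and $\sup_{|x-\zeta|<\delta}\sum_{n=0}^\infty|\hat\phi(x_n)-\hat\phi(\zeta)|<\infty$, where $B_\delta(\zeta)$ is the open ball of radius $\delta$ about $\zeta$ and $x_n\in B_\delta(\zeta)$ are such that $\hat f^n(x_n)=x$; moreover $\hat\phi(\zeta)<0$.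
   Formalization: Added: μ-almost every point of X enters X̂ (otherwise the claim fails, e.g. an invariant half of X never meeting X̂). Made explicit: U(u)⊂X̂ for u in (u_0,u_F) in (S1), the equilibrium state is unique in (M2), and for J∈R the limit Ĥ(J,κ) is assumed to exist. *)

(* Defs.v *)
From HB Require Import structures.
From mathcomp Require Import all_boot all_order all_algebra.
From mathcomp Require Import all_classical all_reals all_analysis.
From mathcomp Require Import measurable_realfun.
Set Implicit Arguments.
Unset Strict Implicit.
Unset Printing Implicit Defensive.
Import Order.TTheory GRing.Theory Num.Theory.
Import numFieldNormedType.Exports.
Local Open Scope classical_set_scope.
Local Open Scope ring_scope.

Notation borel X := (g_sigma_algebraType (@open X)).

Definition homeomorphism_on (S T : topologicalType) (A : set S) (B : set T)
    (h : S -> T) (g : T -> S) : Prop :=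
  [/\ (forall x, A x -> B (h x) /\ g (h x) = x),
      (forall y, B y -> A (g y) /\ h (g y) = y),
      {within A, continuous h} & {within B, continuous g}].

Definition unit_ball (R : realType) (d : nat) : set 'rV[R]_d :=
  [set v | \sum_(i < d) v ord0 i ^+ 2 < 1].

Definition topological_ball (R : realType) (d : nat) (X : topologicalType)
    (A : set X) : Prop :=
  exists (h : 'rV[R]_d -> X) (g : X -> 'rV[R]_d),
    homeomorphism_on (@unit_ball R d) A h g.

Definition iter_derive (R : realType) (V W : normedModType R) (vs : seq V)
    (g : V -> W) : V -> W :=
  foldr (fun v h => (fun x => 'D_v h x)) g vs.

(* C^oo on the open set A. *)
Definition smooth_on (R : realType) (V W : normedModType R) (A : set V)
    (g : V -> W) : Prop :=
  forall (vs : seq V) (x : V), A x ->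
    (forall v, derivable (iter_derive vs g) x v) /\
    {for x, continuous (iter_derive vs g)}.

(* Tangent vectors are row vectors; [metric c x] is the Gram matrix of the
   metric at the point of coordinates [x] in the chart [c].                 *)
Record riemannian_manifold (R : realType) (d : nat) (X : topologicalType) :=
  RiemannianManifold {
    manifold_hausdorff : hausdorff_space X ;
    manifold_second_countable : @second_countable X ;
    chart : Type ;
    chart_dom : chart -> set X ;
    chart_range : chart -> set 'rV[R]_d ;
    coord : chart -> X -> 'rV[R]_d ;
    param : chart -> 'rV[R]_d -> X ;
    chart_dom_open : forall c, open (chart_dom c) ;
    chart_range_open : forall c, open (chart_range c) ;
    chart_homeo : forall c, homeomorphism_on (chart_dom c) (chart_range c)
                                             (coord c) (param c) ;
    chart_cover : forall x, exists c, chart_dom c x ;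
    transition_smooth : forall c c',
      smooth_on (coord c @` (chart_dom c `&` chart_dom c'))
                (coord c' \o param c) ;
    metric : chart -> 'rV[R]_d -> 'M[R]_d ;
    metric_smooth : forall c, smooth_on (chart_range c) (metric c) ;
    metric_sym : forall c x, chart_range c x -> (metric c x)^T = metric c x ;
    metric_pos : forall c x (v : 'rV[R]_d), chart_range c x -> v != 0 ->
      0 < (v *m metric c x *m v^T) ord0 ord0 ;
    metric_change : forall c c' x (v w : 'rV[R]_d),
      (coord c @` (chart_dom c `&` chart_dom c')) x ->
      let tau := coord c' \o param c in
      v *m metric c x *m w^T =
      'D_v tau x *m metric c' (tau x) *m ('D_w tau x)^T
  }.

Section distance.
Context (R : realType) (d : nat) (X : topologicalType).
Variable M : riemannian_manifold R d X.

(* A C^1 curve on [0, 1] is the restriction of a C^1 curve on R. *)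
Definition chart_curve (c : chart M) (gam : R -> 'rV[R]_d) (x y : X) : Prop :=
  [/\ (forall t, derivable gam t 1), continuous (fun t : R => 'D_1 gam t),
      (forall t, 0 <= t <= 1 -> chart_range c (gam t)),
      param c (gam 0) = x & param c (gam 1) = y].

Definition chart_curve_length (c : chart M) (gam : R -> 'rV[R]_d) : R :=
  \int[@lebesgue_measure R]_(t in `[0, 1])
    Num.sqrt (('D_1 gam t *m metric c (gam t) *m ('D_1 gam t)^T) ord0 ord0).

(* Some piecewise C^1 curve from x to y, cut into finitely many pieces each
   contained in the domain of a chart, has length l.                         *)
Inductive curve_of_length : X -> X -> R -> Prop :=
| CurveNil x : curve_of_length x x 0
| CurveCons (c : chart M) gam x y z l :
    chart_curve c gam x y -> curve_of_length y z l ->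
    curve_of_length x z (chart_curve_length c gam + l).

(* +oo when x and y lie in different components. *)
Definition riemannian_dist (x y : X) : \bar R :=
  ereal_inf [set l%:E | l in curve_of_length x y].

Definition riemannian_ball (x : X) (r : R) : set X :=
  [set y | (riemannian_dist x y < r%:E)%E].

End distance.

(* Ergodic theory of a partially defined map: [S : T -> T] matters only on the
   measurable set [D], and the measures considered give full mass to [D].     *)
Section thermodynamics.
Context (R : realType) (d : measure_display) (T : measurableType d).
Variables (D : set T) (S : T -> T).

Definition invariant_prob (nu : probability T R) : Prop :=
  nu D = 1%E /\
  forall B, measurable B -> nu (D `&` S @^-1` B) = nu B.

Definition partition_entropy (nu : probability T R) (k : nat)
    (xi : T -> 'I_k) (n : nat) : R :=
  \sum_(w : {ffun 'I_n -> 'I_k})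
    let q := fine (nu [set x | forall i : 'I_n, xi (iter i S x) = w i]) in
    - (q * ln q).

(* For invariant [nu] the limit superior is a limit, by subadditivity. *)
Definition metric_entropy (nu : probability T R) : \bar R :=
  ereal_sup [set e | exists (k : nat) (xi : T -> 'I_k),
    (forall i, measurable (xi @^-1` [set i])) /\
    e = limn_esup (fun n => (partition_entropy nu xi n / n%:R)%:E)].

Variable psi : T -> R.

Definition admissible (nu : probability T R) : Prop :=
  invariant_prob nu /\ (- (\int[nu]_(x in D) (psi x)%:E) < +oo)%E.

Definition free_energy (nu : probability T R) : \bar R :=
  (metric_entropy nu + \int[nu]_(x in D) (psi x)%:E)%E.

Definition pressure : \bar R :=
  ereal_sup [set free_energy nu | nu in admissible].

Definition equilibrium_state (nu : probability T R) : Prop :=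
  admissible nu /\ free_energy nu = pressure.

Definition the_equilibrium_state (nu : probability T R) : Prop :=
  equilibrium_state nu /\
  forall nu', equilibrium_state nu' ->
    forall B, measurable B -> nu' B = nu B.

Definition conformal (m : probability T R) : Prop :=
  forall A, measurable A -> A `<=` D ->
    (forall x y, A x -> A y -> S x = S y -> x = y) ->
    m (S @` A) = (\int[m]_(x in A) (expR (- psi x))%:E)%E.

End thermodynamics.

Section first_return.
Context (T : Type).
Variables (f : T -> T) (Xh : set T).

Definition first_return (x : T) (n : nat) : Prop :=
  [/\ (0 < n)%N, Xh (iter n f x) &
      forall k, (0 < k)%N -> (k < n)%N -> ~ Xh (iter k f x)].

Definition returning : set T := [set x | Xh x /\ exists n, first_return x n].

(* Equal to 0 when the orbit of x never enters Xh, so that then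
   [return_map x = x]; only points of [returning] are ever relevant.         *)
Definition return_time (x : T) : nat := xget 0%N [set n | first_return x n].

Definition return_map (x : T) : T := iter (return_time x) f x.

Definition return_map_dom (n : nat) (x : T) : Prop :=
  Xh x /\ forall i, (i < n)%N -> returning (iter i return_map x).

Definition return_map_image (n : nat) (A : set T) : set T :=
  iter n return_map @` (A `&` return_map_dom n).

Definition induced_potential (R : realType) (pot : T -> R) (x : T) : R :=
  \sum_(i < return_time x) pot (iter i f x).

End first_return.

Definition prime_period (T : Type) (f : T -> T) (p : nat) (x : T) : Prop :=
  [/\ (0 < p)%N, iter p f x = x &
      forall k, (0 < k)%N -> (k < p)%N -> iter k f x <> x].

Definition exceedance (R : realType) (T : Type) (phi : T -> \bar R) (u : R) :
  set T := [set x | (u%:E < phi x)%E].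

(* The number of i in A, i a natural number, with phi (S^i x) > u. *)
Definition exceedance_count (R : realType) (T : Type) (phi : T -> \bar R)
    (S : T -> T) (u : R) (A : set R) (x : T) : \bar R :=
  (\esum_(i in [set i : nat | A i%:R]) (((u%:E < phi (iter i S x))%E : nat)%:R%:E))%E.

Definition scale_set (R : realType) (a : R) (J : set R) : set R :=
  [set a * t | t in J].

(* nu {N_u (v J) <= kappa} with v = 1 / nu {phi > u}, for the dynamics S. *)
Definition count_cdf (R : realType) (d : measure_display)
    (T : measurableType d) (nu : probability T R) (S : T -> T)
    (phi : T -> \bar R) (J : set R) (kappa : nat) (u : R) : R :=
  let v := (fine (nu (exceedance phi u)))^-1 in
  fine (nu [set x |
    (exceedance_count phi S u (scale_set v J) x <= kappa%:R%:E)%E]).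

Definition interval_S (R : realType) (J : set R) : Prop :=
  exists a b : R, 0 <= a /\ J = `[a, b[%classic.

Definition ring_R (R : realType) (J : set R) : Prop :=
  exists s : seq (R * R),
    (forall ab, ab \in s -> 0 <= ab.1) /\
    J = [set t | exists2 ab, ab \in s & ab.1 <= t < ab.2].

(* Real levels u increasing to an extended real uF. *)
Definition below (R : realType) (uF : \bar R) : set_system R :=
  [set A | exists u1 : R, (u1%:E < uF)%E /\
     forall u, u1 < u -> (u%:E < uF)%E -> A u].

Definition integer_rv_cdf (R : realType) (F : nat -> R) : Prop :=
  exists (d : measure_display) (Om : measurableType d) (Q : probability Om R)
         (Z : Om -> int),
    (forall k, measurable (Z @^-1` [set k])) /\
    forall kappa : nat, Q [set w | Z w <= kappa%:Z] = (F kappa)%:E.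

Section conditions.
Context (R : realType) (d : nat) (X : ptopologicalType).
Variables (M : riemannian_manifold R d X) (f : X -> X) (Xh : set X).
Variables (phi : X -> \bar R) (zeta : X) (pot : X -> R).

Let fh := return_map f Xh.
Let Rdom := returning f Xh.
Let poth := induced_potential f Xh pot.
Let U := exceedance phi.
Let uF := phi zeta.

Definition condition_M1 : Prop :=
  @pressure R _ (borel X) Rdom fh poth = 0%E.

Definition condition_M2 (muh : probability (borel X) R) : Prop :=
  @the_equilibrium_state R _ (borel X) Rdom fh poth muh /\
  exists (m : probability (borel X) R) (C : R) (rho : borel X -> R),
    [/\ m Xh = 1%E /\ @conformal R _ (borel X) Rdom fh poth m,
        0 < C,
        @measurable_fun _ _ (borel X) _ Xh rho,
        (forall x, Xh x -> C^-1 <= rho x <= C) &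
        forall B : set (borel X), measurable B ->
          muh B = (\int[m]_(x in B `&` Xh) (rho x)%:E)%E].

(* The inclusion of U(u) in Xh is what makes the image of U(u) under an
   iterate of the return map meaningful.                                     *)
Definition condition_S1 : Prop :=
  forall eps0 : R, 0 < eps0 < 1 ->
  exists u0 : R,
    [/\ (u0%:E < uF)%E,
        (forall u, u0 - eps0 <= u -> (u%:E < uF)%E ->
           @topological_ball R d X (U u)) &
        forall u, u0 < u -> (u%:E < uF)%E ->
          U u `<=` Xh /\
          exists (n : nat) (eps : R),
            [/\ (0 < n)%N, 0 < eps < eps0,
                U (u0 + eps) `<=` return_map_image f Xh n (U u) &
                return_map_image f Xh n (U u) `<=` U (u0 - eps)]].

Definition condition_S2 : Prop :=
  (exists delta : R,
    [/\ 0 < delta,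
        riemannian_ball M zeta delta `<=` Rdom,
        (forall x y, riemannian_ball M zeta delta x ->
           riemannian_ball M zeta delta y -> fh x = fh y -> x = y) &
        exists preim : X -> nat -> X,
          (forall x n, riemannian_ball M zeta delta x ->
             [/\ riemannian_ball M zeta delta (preim x n),
                 return_map_dom f Xh n (preim x n) &
                 iter n fh (preim x n) = x]) /\
          (ereal_sup [set (\sum_(0 <= n <oo)
                             `|poth (preim x n) - poth zeta|%:E)%E
                     | x in riemannian_ball M zeta delta] < +oo)%E])
  /\ poth zeta < 0.

End conditions.

(* Main.v *)
Require Import Defs.
From HB Require Import structures.
From mathcomp Require Import all_boot all_order all_algebra.
From mathcomp Require Import all_classical all_reals all_analysis.
From mathcomp Require Import measurable_realfun.
From mathcomp Require Import ring lra.
Set Implicit Arguments.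
Unset Strict Implicit.
Unset Printing Implicit Defensive.
Import Order.TTheory GRing.Theory Num.Theory.
Import numFieldNormedType.Exports.
Local Open Scope classical_set_scope.
Local Open Scope ring_scope.

(** The return map and [f] see the same exceedances. Once a level set [U] lies in
    [Xh], the orbit of a point of [Xh] can exceed the level only while visiting
    [Xh], and the [k]-th iterate of the return map is the [k]-th visit. The two
    counting processes differ only in their clocks: [f] counts time, the return map
    counts visits.

    Let [m = mu Xh]. By ergodicity the number of visits before time [t] is [m t] up
    to a small fraction of [t] ([visits_deviation], proved from the maximal ergodic
    inequality). The normalizing constant of the return map is [m v], so on the two
    clocks the windows agree except near their end points, up to a small fraction of
    [v]. The expected number of exceedances during those times is the same small
    fraction, since [mu U = 1 / v]. Hence, started from the conditional measure
    [muh], both counts have nearly the same law ([prob_clock_comparison]).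

    To start from [mu] instead of [muh], let [E] be the event that the count is at
    most [kappa]. Shifting the orbit by a bounded time changes [E] only on a set of
    small measure ([prob_shift]), so [mu (E `&` Xh)] is close to its average
    over shifts of [Xh], that is to the integral over [E] of the proportion of
    time spent in [Xh]; this is close to [m mu E] ([prob_conditioning]). The two
    steps together are [clock_change]. A bound on the mean count makes the
    distribution functions tight, which turns convergence for each [kappa] into
    uniform convergence ([count_cdf_uniform_cvg]).

    Two facts have to be extracted from the hypotheses. Ergodicity comes from the
    uniqueness of the equilibrium state: an invariant set would split [muh] into two
    conditional measures, and since the entropy of a mixture is at most the mixture
    of the entropies, both would be equilibrium states ([equilibrium_ergodic]);
    ergodicity passes from the return map to [f] because almost every orbit enters
    [Xh]. That the measure of the level sets tends to [0] comes from the continuity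
    of [Hh] ([exceedance_prob_cvg0]). *)

(** * Probabilities and expectations as real numbers *)

Section probability_calculus.
Context (R : realType) (d : measure_display) (T : measurableType d).
Variable mu : probability T R.
Implicit Types A B : set T.

Definition prob A : R := fine (mu A).

Lemma probE A : measurable A -> mu A = (prob A)%:E.
Proof. by move=> mA; rewrite fineK// fin_num_measure. Qed.

Lemma prob_ge0 A : 0 <= prob A.
Proof. by rewrite fine_ge0// measure_ge0. Qed.

Lemma prob_le1 A : measurable A -> prob A <= 1.
Proof. by move=> mA; rewrite -lee_fin -probE// probability_le1. Qed.

Lemma probT : prob setT = 1.
Proof. by rewrite /prob probability_setT. Qed.

Lemma prob_mono A B : measurable A -> measurable B -> A `<=` B ->
  prob A <= prob B.
Proof. by move=> mA mB AB; rewrite -lee_fin -!probE// le_measure// inE. Qed.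

Lemma prob_setU A B : measurable A -> measurable B -> [disjoint A & B] ->
  prob (A `|` B) = prob A + prob B.
Proof.
move=> mA mB /disj_setPS AB; apply: EFin_inj.
by rewrite EFinD -!probE ?measureU//; [apply/seteqP; split|exact: measurableU].
Qed.

Lemma prob_setID A B : measurable A -> measurable B ->
  prob A = prob (A `&` B) + prob (A `&` ~` B).
Proof.
move=> mA mB; rewrite -prob_setU -?setIUr ?setUv ?setIT//.
- exact: measurableI.
- by apply: measurableI => //; exact: measurableC.
- by apply/disj_setPS => x [[_ ?] [_ ?]].
Qed.

Lemma prob_setC A : measurable A -> prob (~` A) = 1 - prob A.
Proof.
move=> mA; have := prob_setID measurableT mA.
by rewrite !setTI probT => ->; rewrite addrC addKr.
Qed.

Lemma prob_cover A B C : measurable A -> measurable B -> measurable C ->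
  A `<=` B `|` C -> prob A <= prob B + prob C.
Proof.
move=> mA mB mC ABC; rewrite -lee_fin EFinD -!probE//.
apply: (le_trans (le_measure _ _ _ ABC)); rewrite ?inE//.
  exact: measurableU.
exact: measureU2.
Qed.

Lemma prob_nonincreasing_cvg (F : (set T)^nat) :
  (forall i, measurable (F i)) -> nonincreasing_seq F ->
  prob (F n) @[n --> \oo] --> prob (\bigcap_n F n).
Proof.
move=> mF dF; have mI : measurable (\bigcap_n F n) by exact: bigcap_measurable.
have : mu \o F @ \oo --> mu (\bigcap_n F n).
  by apply: nonincreasing_cvg_mu => //; rewrite -ge0_fin_numE ?fin_num_measure.
rewrite (_ : mu (\bigcap_n F n) = (prob (\bigcap_n F n))%:E) ?probE//.
exact: fine_cvg.
Qed.

Lemma prob_nondecreasing_cvg (F : (set T)^nat) :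
  (forall i, measurable (F i)) -> nondecreasing_seq F ->
  prob (F n) @[n --> \oo] --> prob (\bigcup_n F n).
Proof.
move=> mF dF; have mI : measurable (\bigcup_n F n) by exact: bigcup_measurable.
have : mu \o F @ \oo --> mu (\bigcup_n F n) by exact: nondecreasing_cvg_mu.
rewrite (_ : mu (\bigcup_n F n) = (prob (\bigcup_n F n))%:E) ?probE//.
exact: fine_cvg.
Qed.

Lemma measurable_ltr (g h : T -> R) : measurable_fun setT g ->
  measurable_fun setT h -> measurable [set x | g x < h x].
Proof.
move=> mg mh; rewrite (_ : [set _ | _] =
  setT `&` (fun x => g x < h x) @^-1` [set true]).
  exact: measurable_fun_ltr.
by apply/seteqP; split => x /=; [move=> ->|case].
Qed.

(** Carrying nonnegativity and measurability along with the value makes a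
    (in)equality between expectations follow from a pointwise one. *)
Definition mean (X : T -> R) (e : R) :=
  [/\ measurable_fun setT X, (forall x, 0 <= X x) &
      (\int[mu]_x (X x)%:E)%E = e%:E].

Lemma mean_indic A : measurable A -> mean (\1_A) (prob A).
Proof.
move=> mA; split; [exact: measurable_indic|by []|].
by rewrite integral_indic// setIT; exact: probE.
Qed.

Lemma mean_cst c : 0 <= c -> mean (fun=> c) c.
Proof.
move=> c0; split => //.
by rewrite integral_cst// [X in (_ * X)%E]probability_setT mule1.
Qed.

Lemma meanD X Y a b : mean X a -> mean Y b -> mean (fun x => X x + Y x) (a + b).
Proof.
move=> [mX X0 Xa] [mY Y0 Yb]; split.
- exact: measurable_funD.
- by move=> x; rewrite addr_ge0.
- under eq_integral do rewrite EFinD.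
  by rewrite ge0_integralD ?Xa ?Yb//; try (by move=> x _; rewrite lee_fin);
    exact/measurable_EFinP.
Qed.

Lemma meanZ c X a : 0 <= c -> mean X a -> mean (fun x => c * X x) (c * a).
Proof.
move=> c0 [mX X0 Xa]; split.
- exact: measurable_funM.
- by move=> x; rewrite mulr_ge0.
- under eq_integral do rewrite EFinM.
  rewrite ge0_integralZl ?Xa//; try (by move=> x _; rewrite lee_fin).
  exact/measurable_EFinP.
Qed.

Lemma mean_sum (I : Type) (s : seq I) (X : I -> T -> R) (a : I -> R) :
  (forall i, mean (X i) (a i)) ->
  mean (fun x => \sum_(i <- s) X i x) (\sum_(i <- s) a i).
Proof.
move=> Xa; elim: s => [|i s IH].
  by rewrite (_ : (fun _ => _) = fun=> 0) ?big_nil; [exact: mean_cst|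
    apply/funext => x; rewrite big_nil].
rewrite (_ : (fun _ => _) = fun x => X i x + \sum_(j <- s) X j x) ?big_cons.
  exact: meanD.
by apply/funext => x; rewrite big_cons.
Qed.

Lemma mean_le X Y a b : mean X a -> mean Y b ->
  (forall x, X x <= Y x) -> a <= b.
Proof.
move=> [mX X0 Xa] [mY Y0 Yb] XY; rewrite -lee_fin -Xa -Yb.
by apply: ge0_le_integral => //; try (by move=> x _; rewrite lee_fin);
  exact/measurable_EFinP.
Qed.

End probability_calculus.

(** * Visits of an ergodic system *)

Section visits.
Context (T : Type) (f : T -> T).
Implicit Types (Y : set T) (x : T).

Definition visits Y (n : nat) x : nat := \sum_(i < n) (iter i f x \in Y).

Lemma visitsS Y n x : visits Y n.+1 x = ((x \in Y) + visits Y n (f x))%N.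
Proof.
rewrite /visits big_ord_recl; congr (_ + _)%N.
by apply: eq_bigr => i _; rewrite -iterSr.
Qed.

Lemma visits_recr Y n x : visits Y n.+1 x = (visits Y n x + (iter n f x \in Y))%N.
Proof. by rewrite /visits big_ord_recr. Qed.

Lemma visits_le Y n x : (visits Y n x <= n)%N.
Proof.
rewrite -[leqRHS]muln1 -[X in (X * _)%N]card_ord -sum_nat_const.
by apply: leq_sum => i _; exact: leq_b1.
Qed.

Lemma visits_add Y m n x :
  visits Y (m + n) x = (visits Y m x + visits Y n (iter m f x))%N.
Proof.
elim: n => [|n IH]; first by rewrite addn0 /visits big_ord0 addn0.
by rewrite addnS !visits_recr IH addnA addnC -iterD addnC [(n + m)%N]addnC.
Qed.

Lemma visitsC Y n x : (visits Y n x + visits (~` Y) n x = n)%N.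
Proof.
rewrite /visits -big_split /= -[RHS]muln1 -[X in (X * _)%N]card_ord -sum_nat_const.
by apply: eq_bigr => i _; rewrite in_setC; case: (_ \in _).
Qed.

End visits.

Section measure_preserving.
Context (R : realType) (d : measure_display) (T : measurableType d).
Variables (mu : probability T R) (f : T -> T).

Definition preserves := forall B, measurable B -> mu (f @^-1` B) = mu B.

Definition ergodic := forall B, measurable B -> f @^-1` B = B ->
  prob mu B = 0 \/ prob mu B = 1.

Local Notation visits := (visits f).

Hypothesis mf : measurable_fun setT f.

Lemma preimage_measurable (g : T -> T) B : measurable_fun setT g ->
  measurable B -> measurable (g @^-1` B).
Proof. by move=> mg mB; rewrite -[X in measurable X]setTI; exact: mg. Qed.

Lemma iter_measurable n : measurable_fun setT (iter n f).
Proof.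
elim: n => [|n IH]; first exact: measurable_id.
exact: (measurableT_comp mf IH).
Qed.

Lemma iter_preimage_measurable n B : measurable B -> measurable (iter n f @^-1` B).
Proof. exact/preimage_measurable/iter_measurable. Qed.

Lemma prob_iter_preimage n B : preserves -> measurable B ->
  prob mu (iter n f @^-1` B) = prob mu B.
Proof.
move=> inv; elim: n B => [//|n IH] B mB.
rewrite (_ : _ @^-1` _ = iter n f @^-1` (f @^-1` B))//.
by rewrite IH /prob ?inv//; exact: preimage_measurable.
Qed.

Section one_set.
Variable Y : set T.
Hypothesis mY : measurable Y.

Lemma measurable_visit i : measurable_fun setT
  (fun x => ((iter i f x \in Y) : nat)%:R : R).
Proof.
have -> : (fun x => ((iter i f x \in Y) : nat)%:R : R) =
          \1_(iter i f @^-1` Y).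
  by apply/funext => x; rewrite indicE; congr (_%:R); congr nat_of_bool;
    apply/idP/idP; rewrite !inE.
by apply: measurable_indic; exact: iter_preimage_measurable.
Qed.

Lemma measurable_visits n : measurable_fun setT (fun x => (visits Y n x)%:R : R).
Proof.
rewrite (_ : (fun _ => _) =
  (fun x => \sum_(i < n) ((iter i f x \in Y) : nat)%:R : R)).
  by apply: measurable_sum => i; exact: measurable_visit.
by apply/funext => x; rewrite natr_sum.
Qed.

Section maximal.
Variable alpha : R.
Hypothesis alpha0 : 0 <= alpha.

(** The maximum of the first [N + 1] partial sums [0], [g], [g + g o f], ... of
    [g = 1_Y - alpha], in the recursive form on which Garsia's proof of the
    maximal ergodic theorem rests. *)
Fixpoint max_sum (N : nat) (x : T) : R :=
  if N is N'.+1 then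
    Num.max 0 (((x \in Y) : nat)%:R - alpha + max_sum N' (f x))
  else 0.

Lemma max_sum_ge0 N x : 0 <= max_sum N x.
Proof. by case: N => [|N] //=; rewrite le_max lexx. Qed.

Lemma max_sum_le N x : max_sum N x <= N%:R.
Proof.
elim: N x => [|N IH] x //=; rewrite ge_max ler0n /=.
have := leq_b1 (x \in Y); rewrite -(ler_nat R) -natr1.
by have := IH (f x); have := alpha0; lra.
Qed.

Lemma max_sum_mono N x : max_sum N x <= max_sum N.+1 x.
Proof.
elim: N x => [|N IH] x; first by rewrite {1}/max_sum max_sum_ge0.
rewrite /= !ge_max !le_max lexx /=; apply/orP; right.
by rewrite lerD2l; exact: IH.
Qed.

Lemma max_sum_visits N n x : (n <= N)%N ->
  (visits Y n x)%:R - alpha * n%:R <= max_sum N x.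
Proof.
elim: N n x => [|N IH] [|n] x //.
- by rewrite /visits big_ord0 mulr0 subrr.
- by rewrite /visits big_ord0 mulr0 subrr max_sum_ge0.
move=> nN; rewrite /= le_max; apply/orP; right.
have := IH n (f x) nN; rewrite visitsS natrD -[n.+1%:R]natr1; lra.
Qed.

Lemma measurable_max_sum N : measurable_fun setT (max_sum N).
Proof.
elim: N => [|N IH] /=; first exact: measurable_cst.
apply: measurable_maxr; first exact: measurable_cst.
apply: measurable_funD; last exact: (measurableT_comp IH mf).
by apply: measurable_funB => //; exact: (measurable_visit 0).
Qed.

(** Where it is positive, the maximum is attained by a nonempty partial sum, whose
    first term is [1_Y x - alpha] and whose other terms start at [f x]; elsewhere
    it is [0]. *)
Lemma max_sum_step N x :
  max_sum N.+1 x + alpha * \1_[set x | 0 < max_sum N.+1 x] x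
  <= max_sum N.+1 (f x) + \1_Y x.
Proof.
have le := max_sum_mono N (f x).
have -> : \1_Y x = ((x \in Y) : nat)%:R :> R by rewrite indicE.
rewrite indicE; case: (ltP 0 (max_sum N.+1 x)) => [|h].
  move=> h; rewrite mem_set//; move: h.
  have -> : max_sum N.+1 x =
    Num.max 0 (((x \in Y) : nat)%:R - alpha + max_sum N (f x)) by [].
  rewrite lt_max ltxx orFb => h; rewrite (max_r (ltW h)) mulr1.
  move: (max_sum N (f x)) (max_sum _ _) le => a b; lra.
rewrite memNset; last by move=> /=; rewrite ltNge h.
have := max_sum_ge0 N.+1 (f x); have := ler0n R (x \in Y).
by move: (max_sum N.+1 x) (max_sum _ _) h => a b; rewrite mulr0; lra.
Qed.

Hypothesis inv : preserves.

Lemma mean_comp (X : T -> R) a : mean mu X a -> mean mu (X \o f) a.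
Proof.
move=> [mX X0 Xa]; split => //.
- exact: (measurableT_comp mX mf).
- by move=> x; exact: X0.
rewrite -Xa; symmetry; transitivity (\int[pushforward mu f]_x (X x)%:E)%E.
  by apply: eq_measure_integral => A mA _; exact/esym/inv.
rewrite ge0_integral_pushforward//; first exact/measurable_EFinP.
by move=> x _; rewrite lee_fin.
Qed.

Lemma mean_max_sum N : exists e, mean mu (max_sum N) e.
Proof.
exists (fine (\int[mu]_x (max_sum N x)%:E)%E).
split; [exact: measurable_max_sum|by move=> x; exact: max_sum_ge0|].
have F0 x : setT x -> (0 <= (max_sum N x)%:E)%E by rewrite lee_fin max_sum_ge0.
rewrite fineK// ge0_fin_numE; last exact: integral_ge0.
apply: (@le_lt_trans _ _ (N%:R : R)%:E); last exact: ltry.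
have [_ _ <-] := mean_cst mu (ler0n R N).
apply: ge0_le_integral => //.
- by apply/measurable_EFinP; exact: measurable_max_sum.
- by move=> x _; rewrite lee_fin max_sum_le.
Qed.

(** The two maxima in [max_sum_step] have the same expectation, by invariance, and
    cancel. *)
Lemma maximal_inequality N :
  alpha * prob mu [set x | 0 < max_sum N x] <= prob mu Y.
Proof.
case: N => [|N].
  rewrite (_ : [set _ | _] = set0) ?/prob ?measure0 ?mulr0 ?fine_ge0 ?measure_ge0//.
  by apply/seteqP; split => x //=; rewrite ltxx.
have mB : measurable [set x | 0 < max_sum N.+1 x].
  by apply: measurable_ltr => //; exact: measurable_max_sum.
have [e Fe] := mean_max_sum N.+1.
have := mean_le (meanD Fe (meanZ alpha0 (mean_indic mu mB)))
                (meanD (mean_comp Fe) (mean_indic mu mY)) (max_sum_step N).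
by rewrite lerD2l.
Qed.

End maximal.

Lemma measurable_above_line (alpha K : R) :
  measurable [set x | exists n, alpha * n%:R + K < (visits Y n x)%:R].
Proof.
rewrite (_ : [set _ | _] =
         \bigcup_n [set x | alpha * n%:R + K < (visits Y n x)%:R]).
  apply: bigcup_measurable => n _; apply: measurable_ltr => //.
  exact: measurable_visits.
by apply/seteqP; split => [x [n h]|x [n _ h]]; exists n.
Qed.

(** Being above the line by arbitrarily much is an invariant property, so it holds
    almost nowhere or almost everywhere. In the second case some partial sum of
    [1_Y - alpha] is positive almost everywhere and the maximal inequality gives
    [alpha <= mu Y]. *)
Lemma visits_above_line (alpha eta : R) : preserves -> ergodic ->
  prob mu Y < alpha -> 0 < eta ->
  exists K : nat,
    prob mu [set x | exists n, alpha * n%:R + K%:R < (visits Y n x)%:R] < eta.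
Proof.
move=> inv erg Yalpha eta0.
pose E (K : nat) := [set x | exists n, alpha * n%:R + K%:R < (visits Y n x)%:R].
have alpha0 : 0 <= alpha by apply: le_trans (ltW Yalpha); exact: prob_ge0.
have mE K : measurable (E K) by exact: measurable_above_line.
have dE : nonincreasing_seq E.
  move=> K L KL; apply/subsetPset => x [n h]; exists n.
  by apply: le_lt_trans h; rewrite lerD2l ler_nat.
have cE := prob_nonincreasing_cvg (mu := mu) mE dE.
set B := \bigcap_n E n in cE.
have mB : measurable B by exact: bigcap_measurable.
(* A time step changes the excess by a bounded amount. *)
have BE : f @^-1` B = B.
  apply/seteqP; split => x Bx K _.
    have [n h] := Bx (K + Num.bound alpha)%N I.
    exists n.+1; rewrite visitsS natrD -natr1.
    have := archi_boundP alpha0; rewrite natrD in h.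
    have := ler0n R (x \in Y); lra.
  have [[|n] h] := Bx K.+1 I.
    by move: h; rewrite /visits big_ord0 mulr0 add0r ltrn0.
  exists n; move: h; rewrite visitsS natrD -!natr1.
  have : ((x \in Y) : nat)%:R <= 1 :> R by rewrite lern1 leq_b1.
  lra.
have [B0|B1] := erg B mB BE.
  rewrite B0 in cE; have /cvgrPdist_lt /(_ eta eta0)[K _ /(_ K (leqnn K))] := cE.
  by rewrite /= sub0r normrN ger0_norm ?prob_ge0// => h; exists K.
exfalso; move: Yalpha; apply/negP; rewrite -leNgt.
pose G N := [set x | 0 < max_sum alpha N x].
have mG N : measurable (G N).
  by apply: measurable_ltr => //; exact: measurable_max_sum.
have dG : nondecreasing_seq G.
  apply/nondecreasing_seqP => N; apply/subsetPset => x /= h.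
  exact: lt_le_trans (max_sum_mono _ _ _).
have cG := prob_nondecreasing_cvg (mu := mu) mG dG.
have G1 : prob mu (\bigcup_n G n) = 1.
  apply/eqP; rewrite eq_le prob_le1 /=; last exact: bigcup_measurable.
  rewrite -[leLHS]B1.
  apply: (prob_mono _ mB); first exact: bigcup_measurable.
  move=> x /(_ 0%N I)[n h]; exists n => //=.
  have := max_sum_visits alpha x (leqnn n); rewrite addr0 in h.
  by apply: lt_le_trans; rewrite subr_gt0.
rewrite G1 in cG; rewrite -[alpha]mulr1.
apply: (@closed_cvg _ _ \oo eventually_filter (fun N => alpha * prob mu (G N))
  (fun y => y <= prob mu Y)); first exact: closed_le.
  by apply: nearW => N; exact: maximal_inequality.
by apply: cvgM => //; exact: cvg_cst.
Qed.

End one_set.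

Definition deviation (Y : set T) (eps K : R) : set T :=
  [set x | exists n,
    eps * n%:R + K < `|(visits Y n x)%:R - prob mu Y * n%:R|].

Lemma measurable_deviation Y eps K : measurable Y ->
  measurable (deviation Y eps K).
Proof.
move=> mY; rewrite (_ : deviation _ _ _ = \bigcup_n [set x |
    eps * n%:R + K < `|(visits Y n x)%:R - prob mu Y * n%:R|]).
  apply: bigcup_measurable => n _; apply: measurable_ltr => //.
  apply: measurableT_comp => //; apply: measurable_funB => //.
  exact: measurable_visits.
by apply/seteqP; split => [x [n h]|x [n _ h]]; exists n.
Qed.

(** The lower deviation is the upper one for the complement of [Y]. This is the
    ergodic theorem for the indicator of [Y], in a form uniform in time. *)
Lemma visits_deviation Y (eps eta : R) : measurable Y -> preserves -> ergodic ->
  0 < eps -> 0 < eta ->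
  exists2 K : R, 0 <= K & prob mu (deviation Y eps K) < eta.
Proof.
move=> mY inv erg eps0 eta0; have mCY := measurableC mY.
have half : 0 < eta / 2 by lra.
have [|K1 h1] :=
  @visits_above_line _ mY (prob mu Y + eps) (eta / 2) inv erg _ half.
  by rewrite ltrDl.
have [|K2 h2] :=
  @visits_above_line _ mCY (prob mu (~` Y) + eps) (eta / 2) inv erg _ half.
  by rewrite ltrDl.
exists (maxn K1 K2)%:R; first exact: ler0n.
rewrite [eta]splitr; apply: le_lt_trans (ltrD h1 h2); apply: prob_cover.
- exact: measurable_deviation.
- exact: measurable_above_line.
- exact: measurable_above_line.
move=> x [n]; rewrite lter_normr => /orP[] h; [left|right]; exists n.
  have : (K1%:R <= (maxn K1 K2)%:R :> R) by rewrite ler_nat leq_maxl.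
  lra.
have : (K2%:R <= (maxn K1 K2)%:R :> R) by rewrite ler_nat leq_maxr.
have := congr1 (fun k => k%:R : R) (visitsC f Y n x); rewrite natrD prob_setC//.
lra.
Qed.

End measure_preserving.

(** * Uniqueness of the equilibrium state forces ergodicity *)

Section limsup.
Context (R : realType).
Implicit Types (u : nat -> R) (l : R).
Local Open Scope ereal_scope.

Lemma limn_esup_le_near u l : limn_esup (fun n => (u n)%:E) <= l%:E ->
  forall e : R, (0 < e)%R -> \forall n \near \oo, (u n <= l + e)%R.
Proof.
move=> ul e e0; have : limn_esup (fun n => (u n)%:E) < (l + e)%:E.
  by rewrite (le_lt_trans ul)// lte_fin ltrDl.
move=> /ereal_inf_lt[_ [A FA <-] /ltW supA]; apply: filterS FA => n An.
rewrite -lee_fin; apply: le_trans supA; apply: ereal_sup_ubound.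
by exists n.
Qed.

Lemma near_limn_esup_le u l :
  (forall e : R, (0 < e)%R -> \forall n \near \oo, (u n <= l + e)%R) ->
  limn_esup (fun n => (u n)%:E) <= l%:E.
Proof.
move=> ul; apply/lee_addgt0Pr => e e0.
apply: le_trans (ereal_inf_lbound _) _.
  by exists [set n | (u n <= l + e)%R]; [exact: ul|reflexivity].
by apply: ge_ereal_sup => _ [n /= h <-]; rewrite lee_fin.
Qed.

Lemma limn_esup_ge0 u : (forall n, 0 <= u n)%R ->
  0 <= limn_esup (fun n => (u n)%:E).
Proof.
move=> u0; apply: le_ereal_inf_tmp => _ [A [n _ nA] <-].
apply: (@le_trans _ _ (u n)%:E); first by rewrite lee_fin.
by apply: ereal_sup_ubound; exists n => //; exact: (nA n (leqnn n)).
Qed.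

End limsup.

Section entropy_function.
Context (R : realType).
Implicit Types x y : R.

Definition entropy_term x : R := - (x * ln x).

Lemma entropy_term0 : entropy_term 0 = 0.
Proof. by rewrite /entropy_term mul0r oppr0. Qed.

Lemma entropy_term_ge0 x : 0 <= x -> x <= 1 -> 0 <= entropy_term x.
Proof.
move=> x0 x1; rewrite /entropy_term oppr_ge0 mulr_ge0_le0//.
exact: ln_le0.
Qed.

Lemma entropy_termD x y : 0 <= x -> 0 <= y ->
  entropy_term (x + y) <= entropy_term x + entropy_term y.
Proof.
rewrite le_eqVlt => /predU1P[<-|x0]; first by rewrite entropy_term0 !add0r.
rewrite le_eqVlt => /predU1P[<-|y0]; first by rewrite entropy_term0 !addr0.
rewrite /entropy_term mulrDl opprD lerD// lerN2 ler_pM2l// ler_ln ?posrE ?addr_gt0//.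
  by rewrite lerDl ltW.
by rewrite lerDr ltW.
Qed.

Lemma entropy_termM x y : 0 <= x -> 0 <= y ->
  entropy_term (x * y) = x * entropy_term y + y * entropy_term x.
Proof.
rewrite le_eqVlt => /predU1P[<-|x0]; first
  by rewrite entropy_term0 !mul0r entropy_term0 mulr0 addr0.
rewrite le_eqVlt => /predU1P[<-|y0]; first
  by rewrite entropy_term0 !mul0r !mulr0 entropy_term0 addr0.
by rewrite /entropy_term lnM ?posrE//; ring.
Qed.

End entropy_function.

Section mixture.
Context (R : realType) (d : measure_display) (T : measurableType d).
Implicit Types (nu : probability T R).

Lemma sum_fibers nu (W : finType) (g : T -> W) :
  (forall w, measurable (g @^-1` [set w])) ->
  \sum_w prob nu (g @^-1` [set w]) = 1.
Proof.
move=> mg.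
have [_ _ sE] := mean_sum (index_enum W) (fun w => mean_indic nu (mg w)).
have [_ _ oneE] := mean_cst nu (@ler01 R).
apply: EFin_inj; rewrite -sE -oneE; apply: eq_integral => x _; congr EFin.
rewrite (bigD1 (g x))//= big1 ?addr0; first by rewrite indicE mem_set.
move=> w wg; rewrite indicE memNset//= => gw.
by rewrite gw eqxx in wg.
Qed.

Definition mixture nu (a : R) nu1 (b : R) nu2 := forall A, measurable A ->
  prob nu A = a * prob nu1 A + b * prob nu2 A.

Variables (nu nu1 nu2 : probability T R) (a b : R).
Hypotheses (a0 : 0 < a) (b0 : 0 < b) (ab1 : a + b = 1).
Hypothesis mix : mixture nu a nu1 b nu2.

Lemma mixture_integral D (g : T -> \bar R) : measurable D ->
  measurable_fun D g -> (forall x, D x -> 0 <= g x)%E ->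
  (\int[nu]_(x in D) g x =
   a%:E * \int[nu1]_(x in D) g x + b%:E * \int[nu2]_(x in D) g x)%E.
Proof.
move=> mD mg g0.
pose m1 := mscale (NngNum (ltW a0)) nu1; pose m2 := mscale (NngNum (ltW b0)) nu2.
transitivity (\int[measure_add m1 m2]_(x in D) g x)%E.
  apply: eq_measure_integral => A mA _.
  transitivity (m1 A + m2 A)%E; last exact/esym/measure_addE.
  rewrite /m1 /m2 /mscale /= (probE nu mA) (probE nu1 mA).
  by rewrite (probE nu2 mA) mix// EFinD !EFinM.
by rewrite ge0_integral_measure_add// !ge0_integral_mscale.
Qed.

Variables (S : T -> T) (mS : measurable_fun setT S).

Lemma measurable_cylinder (k n : nat) (xi : T -> 'I_k) (w : {ffun 'I_n -> 'I_k}) :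
  (forall i, measurable (xi @^-1` [set i])) ->
  measurable [set x | forall i : 'I_n, xi (iter i S x) = w i].
Proof.
move=> mxi; rewrite (_ : [set _ | _] =
  \bigcap_(i in [set: 'I_n]) (iter i S @^-1` (xi @^-1` [set w i]))).
  apply: fin_bigcap_measurable => // i _.
  exact: iter_preimage_measurable.
by apply/seteqP; split => [x h i _|x h i]; [exact: h|exact: (h i I)].
Qed.

Lemma cylinder_fiber (k n : nat) (xi : T -> 'I_k) (w : {ffun 'I_n -> 'I_k}) :
  [set x | forall i : 'I_n, xi (iter i S x) = w i] =
  (fun x => [ffun i : 'I_n => xi (iter i S x)]) @^-1` [set w].
Proof.
apply/seteqP; split => x /= h; first by apply/ffunP => i; rewrite ffunE.
by move=> i; rewrite -h ffunE.
Qed.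

Lemma partition_entropy_ge0 k n (xi : T -> 'I_k) :
  (forall i, measurable (xi @^-1` [set i])) ->
  0 <= partition_entropy S nu xi n.
Proof.
move=> mxi; apply: sumr_ge0 => w _; apply: entropy_term_ge0.
  exact: prob_ge0.
by apply: prob_le1; exact: measurable_cylinder.
Qed.

Lemma metric_entropy_ge0 : (0 <= metric_entropy S nu)%E.
Proof.
pose xi : T -> 'I_1 := fun=> ord0.
have mxi i : measurable (xi @^-1` [set i]).
  by rewrite (_ : _ @^-1` _ = setT)//; apply/seteqP; split => x //= _; rewrite [i]ord1.
apply: le_trans (ereal_sup_ubound _); last by exists 1%N, xi.
by apply: limn_esup_ge0 => n; rewrite divr_ge0// partition_entropy_ge0.
Qed.

(** The additive constant is the entropy of the choice of a component. It does not
    depend on [n], so it disappears from the entropy per unit of time. *)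
Lemma partition_entropy_mixture k n (xi : T -> 'I_k) :
  (forall i, measurable (xi @^-1` [set i])) ->
  partition_entropy S nu xi n <=
  a * partition_entropy S nu1 xi n + b * partition_entropy S nu2 xi n
  + (entropy_term a + entropy_term b).
Proof.
move=> mxi; pose g x := [ffun i : 'I_n => xi (iter i S x)].
have mg w : measurable (g @^-1` [set w]).
  by rewrite -cylinder_fiber; exact: measurable_cylinder.
have E (m : probability T R) :
    partition_entropy S m xi n = \sum_w entropy_term (prob m (g @^-1` [set w])).
  by apply: eq_bigr => w _; rewrite -cylinder_fiber.
rewrite !E -[entropy_term a]mulr1 -[entropy_term b]mulr1.
rewrite -{1}(sum_fibers nu1 mg) -(sum_fibers nu2 mg).
rewrite !mulr_sumr -!big_split /=; apply: ler_sum => w _.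
have [p1 p2] := (prob_ge0 nu1 (g @^-1` [set w]), prob_ge0 nu2 (g @^-1` [set w])).
have [a1 b1] := (ltW a0, ltW b0).
rewrite mix//; apply: le_trans (entropy_termD (mulr_ge0 a1 p1) (mulr_ge0 b1 p2)) _.
rewrite !entropy_termM//; lra.
Qed.

Lemma metric_entropy_mixture (h1 h2 : R) :
  (metric_entropy S nu1 <= h1%:E)%E -> (metric_entropy S nu2 <= h2%:E)%E ->
  (metric_entropy S nu <= (a * h1 + b * h2)%:E)%E.
Proof.
move=> le1 le2; apply: ge_ereal_sup => _ [k [xi [mxi ->]]].
apply: near_limn_esup_le => e e0; have e2 : 0 < e / 2 by lra.
have /limn_esup_le_near/(_ _ e2) : (limn_esup (fun n =>
    (partition_entropy S nu1 xi n / n%:R)%:E) <= h1%:E)%E.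
  by apply: le_trans le1; apply: ereal_sup_ubound; exists k, xi.
have /limn_esup_le_near/(_ _ e2) : (limn_esup (fun n =>
    (partition_entropy S nu2 xi n / n%:R)%:E) <= h2%:E)%E.
  by apply: le_trans le2; apply: ereal_sup_ubound; exists k, xi.
have [a1 b1] : a <= 1 /\ b <= 1 by move: a0 b0 ab1; lra.
have c0 : 0 <= entropy_term a + entropy_term b
  by rewrite addr_ge0// entropy_term_ge0// ltW.
move=> near2 near1; near=> n.
have n0 : 0 < n%:R :> R by rewrite ltr0n; near: n; exists 1%N.
have cn : (entropy_term a + entropy_term b) / n%:R <= e / 2.
  rewrite ler_pdivrMr// mulrC -ler_pdivrMr//; apply: ltW.
  apply: lt_le_trans (archi_boundP _) _; first by rewrite divr_ge0// ltW.
  by rewrite ler_nat; near: n; exact: nbhs_infty_ge.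
have h2n : partition_entropy S nu2 xi n / n%:R <= h2 + e / 2 by near: n.
have h1n : partition_entropy S nu1 xi n / n%:R <= h1 + e / 2 by near: n.
have := partition_entropy_mixture n mxi.
rewrite -(ler_pM2r (x := n%:R^-1)) ?invr_gt0// !mulrDl -!mulrA => /le_trans; apply.
move: cn h1n h2n; rewrite mulrDl.
set p1 := _ * _; set p2 := _ * _; move=> cn h1n h2n.
have : a * (partition_entropy S nu1 xi n / n%:R) <= a * (h1 + e / 2).
  by rewrite ler_pM2l.
have : b * (partition_entropy S nu2 xi n / n%:R) <= b * (h2 + e / 2).
  by rewrite ler_pM2l.
have -> : b = 1 - a by rewrite -ab1 addrAC subrr add0r.
move: (partition_entropy S nu1 xi n / n%:R) (partition_entropy S nu2 xi n / n%:R).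
move=> x y; lra.
Unshelve. all: end_near. Qed.

End mixture.

Lemma finite_mixture (R : realType) (a b : R) (x y z : \bar R) :
  0 < a -> 0 < b -> (0 <= x)%E -> (0 <= y)%E ->
  z = (a%:E * x + b%:E * y)%E -> z != +oo%E ->
  exists x' y' : R, [/\ x = x'%:E, y = y'%:E & z = (a * x' + b * y')%:E].
Proof.
move=> a0 b0; case: x => [x||]//; case: y => [y||]// _ _ ->.
- by exists x, y.
- by rewrite gt0_muley ?lte_fin// addey.
- by rewrite gt0_muley ?lte_fin// addye.
- by rewrite !gt0_muley ?lte_fin// addey.
Qed.

Section conditional.
Context (R : realType) (d : measure_display) (T : measurableType d).
Variable nu : probability T R.

Lemma conditional_probability B : measurable B -> 0 < prob nu B ->
  exists nuB : probability T R, forall A, measurable A ->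
    prob nuB A = (prob nu B)^-1 * prob nu (A `&` B).
Proof.
move=> mB B0; exists (mnormalize (mrestr nu mB) nu) => A mA.
rewrite /prob /= /mnormalize /= /mrestr setTI (probE nu mB).
rewrite eqe gt_eqF//= (probE nu (measurableI _ _ mA mB)) -EFinM /=.
by rewrite mulrC.
Qed.

(** An invariant set [B] splits [nu] into two conditional measures, both invariant.
    Their free energies are at most the pressure [0], and their average is at
    least the free energy of [nu], which is [0]. Hence both are equilibrium
    states, and by uniqueness [nu] conditioned on [B] is [nu]. *)
Lemma equilibrium_ergodic (D : set T) (S : T -> T) (psi : T -> R) B :
  measurable D -> measurable_fun setT S -> measurable_fun setT psi ->
  pressure D S psi = 0%E -> the_equilibrium_state D S psi nu ->
  measurable B -> S @^-1` B = B -> prob nu B = 0 \/ prob nu B = 1.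
Proof.
move=> mD mS mpsi P0 [[[[nuD inv] adm] free] uniq] mB SB.
have [->|B0] := eqVneq (prob nu B) 0; [by left|right].
have {}B0 : 0 < prob nu B by rewrite lt_neqAle eq_sym B0 prob_ge0.
apply/eqP/negPn/negP => B1.
have {}B1 : prob nu B < 1 by rewrite lt_neqAle B1 prob_le1.
have mCB := measurableC mB.
have SCB : S @^-1` (~` B) = ~` B by rewrite -[in RHS]SB.
have CB0 : 0 < prob nu (~` B) by rewrite prob_setC// subr_gt0.
have [nu1 nu1E] := conditional_probability mB B0.
have [nu2 nu2E] := conditional_probability mCB CB0.
have mix : mixture nu (prob nu B) nu1 (prob nu (~` B)) nu2.
  move=> A mA; rewrite nu1E// nu2E// !mulrA !divff ?gt_eqF// !mul1r.
  exact: prob_setID.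
have invC (E : set T) (nuE : probability T R) : measurable E -> S @^-1` E = E ->
    0 < prob nu E ->
    (forall A, measurable A -> prob nuE A = (prob nu E)^-1 * prob nu (A `&` E)) ->
    invariant_prob D S nuE.
  move=> mE SE E0 nuEE; split.
    rewrite probE// nuEE// -[1%E]/(1%:E); congr EFin.
    rewrite (_ : prob nu (D `&` E) = prob nu E) ?mulVf ?gt_eqF//.
    by rewrite /prob -(inv E mE) SE.
  move=> A mA; have mSA := preimage_measurable mS mA.
  rewrite !probE//; last exact: measurableI.
  rewrite !nuEE//; last exact: measurableI.
  congr (_ * _)%:E; rewrite /prob -(inv (A `&` E))//; last exact: measurableI.
  by rewrite preimage_setI SE setIA.
have mpsiD : measurable_fun D (fun x => (psi x)%:E).
  by apply/measurable_EFinP; exact: measurable_funTS.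
have [invnu1 invnu2] := (invC _ nu1 mB SB B0 nu1E, invC _ nu2 mCB SCB CB0 nu2E).
have h0 (m : probability T R) : (0 <= metric_entropy S m)%E.
  exact: metric_entropy_ge0.
pose I (m : probability T R) := (\int[m]_(x in D) (psi x)%:E)%E.
pose Ip (m : probability T R) :=
  (\int[m]_(x in D) ((fun x => (psi x)%:E) ^\+ x))%E.
pose In (m : probability T R) :=
  (\int[m]_(x in D) ((fun x => (psi x)%:E) ^\- x))%E.
have IE m : I m = (Ip m - In m)%E by rewrite /I integralE.
have Ip0 m : (0 <= Ip m)%E by apply: integral_ge0.
have In0 m : (0 <= In m)%E by apply: integral_ge0.
have mixp : Ip nu = ((prob nu B)%:E * Ip nu1 + (prob nu (~` B))%:E * Ip nu2)%E.
  by apply: mixture_integral => //; exact: measurable_funepos.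
have mixn : In nu = ((prob nu B)%:E * In nu1 + (prob nu (~` B))%:E * In nu2)%E.
  by apply: mixture_integral => //; exact: measurable_funeneg.
rewrite /free_energy -/(I nu) P0 in free; rewrite -/(I nu) in adm.
(* The free energy of the equilibrium state being finite, so are both parts of
   the integral of the potential, and then also those for the conditioned
   measures. *)
have Infin : In nu != +oo%E.
  by apply: contraTneq adm => InE; rewrite IE InE addeNy.
have Ipfin : Ip nu != +oo%E.
  apply/eqP => IpE; move: free; rewrite IE IpE.
  case: (In nu) (In0 nu) Infin => [n||]// _ _.
  by case: (metric_entropy S nu) (h0 nu).
have [p1 [p2 [Ip1 Ip2 pE]]] := finite_mixture B0 CB0 (Ip0 nu1) (Ip0 nu2) mixp Ipfin.
have [n1 [n2 [In1 In2 nE]]] := finite_mixture B0 CB0 (In0 nu1) (In0 nu2) mixn Infin.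
have FEle (m : probability T R) (p n : R) : Ip m = p%:E -> In m = n%:E ->
    invariant_prob D S m -> admissible D S psi m /\
    exists2 h, metric_entropy S m = h%:E & h <= n - p.
  move=> IpE InE invm; have Im : I m = (p - n)%:E by rewrite IE IpE InE.
  have adm_m : admissible D S psi m by split => //; rewrite -/(I m) Im ltry.
  split => //; have : (free_energy D S psi m <= 0)%E.
    by rewrite -P0; apply: ereal_sup_ubound; exists m.
  rewrite /free_energy -/(I m) Im.
  case: (metric_entropy S m) (h0 m) => [h||]//= _; rewrite -EFinD lee_fin => hle.
  by exists h => //; lra.
have [adm1 [h1 h1E h1le]] := FEle nu1 p1 n1 Ip1 In1 invnu1.
have [adm2 [h2 h2E h2le]] := FEle nu2 p2 n2 Ip2 In2 invnu2.
have : (metric_entropy S nu <= (prob nu B * h1 + prob nu (~` B) * h2)%:E)%E.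
  apply: (metric_entropy_mixture (nu1 := nu1) (nu2 := nu2)) => //.
  - by rewrite prob_setC//; lra.
  - by rewrite h1E.
  - by rewrite h2E.
move: free; rewrite IE pE nE.
case: (metric_entropy S nu) => [h||]//; rewrite -EFinB -EFinD => -[hE].
rewrite lee_fin => hle.
have h1ge : n1 - p1 <= h1.
  rewrite -subr_le0 -(pmulr_rle0 _ B0).
  have : 0 <= prob nu (~` B) * (n2 - p2 - h2) by rewrite mulr_ge0 ?prob_ge0// subr_ge0.
  move: hE hle; lra.
have eq1 : equilibrium_state D S psi nu1.
  split => //; rewrite P0 /free_energy -/(I nu1) IE Ip1 In1 h1E -EFinB -EFinD.
  by congr EFin; lra.
have := uniq nu1 eq1 B mB; rewrite !probE// nu1E// setIid mulVf ?gt_eqF// => -[].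
by move=> h1'; rewrite -h1' ltxx in B1.
Qed.

End conditional.

(** * The first return map *)

Section first_return_map.
Context (T : Type) (f : T -> T) (Y : set T).
Local Notation fh := (return_map f Y).

Lemma first_return_unique x m n :
  first_return f Y x m -> first_return f Y x n -> m = n.
Proof.
move=> [m0 Ym nm] [n0 Yn nn]; apply/eqP; rewrite eqn_leq.
by apply/andP; split; rewrite leqNgt; apply/negP => h;
  [exact: nm _ n0 h Yn|exact: nn _ m0 h Ym].
Qed.

Lemma return_timeE x n : first_return f Y x n -> return_time f Y x = n.
Proof.
move=> xn; rewrite /return_time.
exact: xget_subset1 xn (fun m k hm hk => first_return_unique hm hk).
Qed.

Lemma iter_preimage_invariant n B : f @^-1` B = B -> iter n f @^-1` B = B.
Proof.
move=> fB; elim: n => [//|n IH].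
by rewrite (_ : iter n.+1 f @^-1` B = iter n f @^-1` (f @^-1` B))// fB.
Qed.

Lemma return_map_invariant B : f @^-1` B = B -> fh @^-1` B = B.
Proof.
move=> fB; apply/seteqP; split => x; rewrite /return_map /=.
  by rewrite -{2}(iter_preimage_invariant (return_time f Y x) fB).
by rewrite -{1}(iter_preimage_invariant (return_time f Y x) fB).
Qed.

(** Between a point of [Y] and its first return there is exactly one visit, the
    starting time itself, so the clock advances by one at each iterate of the
    return map. *)
Lemma iter_return_map_visits t x : Y x -> Y (iter t f x) ->
  iter (visits f Y t x) fh x = iter t f x.
Proof.
elim/ltn_ind: t x => -[|t] IH x Yx Yt; first by rewrite /visits big_ord0.
have exr : exists r, (0 < r)%N && `[< Y (iter r f x) >].
  by exists t.+1; apply/asboolP.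
case: (ex_minnP exr) => r /andP[r0 /asboolP Yr] rmin.
have xr : first_return f Y x r.
  split => // k k0 kr Yk; have := rmin k; rewrite k0 /= leqNgt kr /=.
  by move=> /(_ (asboolT Yk)).
have rt : (r <= t.+1)%N by apply: rmin; rewrite /=; apply/asboolP.
have V1 : visits f Y r x = 1%N.
  rewrite -(prednK r0) visitsS mem_set// /visits big1 ?addn0// => i _.
  rewrite memNset// -iterSr => Yi; case: xr => _ _ /(_ i.+1 isT); apply => //.
  by rewrite -{2}(prednK r0) ltnS ltn_ord.
have tE : t.+1 = (r + (t.+1 - r))%N by rewrite subnKC.
have fhx : fh x = iter r f x by rewrite /return_map (return_timeE xr).
have Yr' : Y (iter (t.+1 - r) f (iter r f x)).
  by rewrite -iterD addnC -tE.
rewrite tE visits_add V1 add1n iterSr fhx IH//; first by rewrite -iterD addnC.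
by rewrite ltn_subrL r0.
Qed.

End first_return_map.

Section measurable_return_map.
Context (R : realType) (d : measure_display) (T : measurableType d).
Variables (f : T -> T) (Y : set T).
Hypotheses (mf : measurable_fun setT f) (mY : measurable Y).
Local Notation fh := (return_map f Y).

Lemma measurable_first_return n : measurable [set x | first_return f Y x n].
Proof.
have [->|n0] := posnP n.
  by rewrite (_ : [set _ | _] = set0)//; apply/seteqP; split => x // -[].
rewrite (_ : [set _ | _] = (iter n f @^-1` Y) `&`
   \bigcap_(k in [set k | (0 < k < n)%N]) ~` (iter k f @^-1` Y)).
  apply: measurableI; first exact: iter_preimage_measurable.
  apply: bigcap_measurableType => k _; apply: measurableC.
  exact: iter_preimage_measurable.
apply/seteqP; split => [x [_ Yx nx]|x [Yx nx]].
  by split => // k /andP[k0 kn]; exact: nx.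
by split => // k k0 kn; apply: nx => /=; rewrite k0.
Qed.

Lemma measurable_return_time n : measurable [set x | return_time f Y x = n].
Proof.
have m1 : measurable (\bigcup_k [set x | first_return f Y x k]).
  by apply: bigcup_measurable => k _; exact: measurable_first_return.
rewrite (_ : [set _ | _] = [set x | first_return f Y x n] `|`
   ((if n == 0%N then setT else set0) `\` \bigcup_k [set x | first_return f Y x k])).
  apply: measurableU; first exact: measurable_first_return.
  by apply: measurableD => //; case: ifP.
apply/seteqP; split => x /=.
  have [[k xk]|nx] := pselect (exists k, first_return f Y x k).
    by rewrite (return_timeE xk) => <-; left.
  rewrite /return_time xgetPN; last by move=> k xk; apply: nx; exists k.
  by move=> <-; right; split => // -[k _ xk]; apply: nx; exists k.
move=> [xn|[]]; first exact: return_timeE.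
case: eqP => // -> _ nx.
by rewrite /return_time xgetPN// => k xk; apply: nx; exists k.
Qed.

Lemma measurable_piecewise d' (T' : measurableType d') (F : nat -> T -> T') :
  (forall n, measurable_fun setT (F n)) ->
  measurable_fun setT (fun x => F (return_time f Y x) x).
Proof.
move=> mF _ B mB; rewrite setTI (_ : _ @^-1` _ =
  \bigcup_n ([set x | return_time f Y x = n] `&` F n @^-1` B)).
  apply: bigcup_measurable => n _; apply: measurableI.
    exact: measurable_return_time.
  by rewrite -[X in measurable X]setTI; exact: mF.
by apply/seteqP; split => [x h|x [n _ [<-]]//]; exists (return_time f Y x).
Qed.

Lemma measurable_return_map : measurable_fun setT fh.
Proof.
by apply: (measurable_piecewise (F := fun n => iter n f)) => n; exact: iter_measurable.
Qed.

Lemma measurable_induced_potential (pot : T -> R) : measurable_fun setT pot ->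
  measurable_fun setT (induced_potential f Y pot).
Proof.
move=> mpot.
apply: (measurable_piecewise (F := fun n x => \sum_(i < n) pot (iter i f x))) => n.
by apply: measurable_sum => i; exact: measurableT_comp mpot (iter_measurable mf i).
Qed.

Lemma measurable_returning : measurable (returning f Y).
Proof.
rewrite (_ : returning f Y = Y `&` \bigcup_k [set x | first_return f Y x k]).
  apply: measurableI => //.
  by apply: bigcup_measurable => k _; exact: measurable_first_return.
apply/seteqP; split => [x [Yx [n xn]]|x [Yx [n _ xn]]]; first by split => //; exists n.
by split => //; exists n.
Qed.

(** Almost every point of [B] enters [Y], and does so inside [B] by invariance. *)
Lemma invariant_null (mu : probability T R) B : preserves mu f ->
  {ae mu, forall x, exists n, first_return f Y x n} ->
  measurable B -> f @^-1` B = B -> prob mu (B `&` Y) = 0 -> prob mu B = 0.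
Proof.
move=> inv enter mB fB BY0; have mBY := measurableI _ _ mB mY.
suff /(negligibleP _ mB) : mu.-negligible B by rewrite /prob => ->.
apply: (@negligibleS _ _ _ _ ((~` [set x | exists n, first_return f Y x n]) `|`
     \bigcup_n (iter n f @^-1` (B `&` Y)))).
  move=> x Bx; have [[n xn]|nx] := pselect (exists n, first_return f Y x n).
    right; exists n => //; split; last by case: xn.
    by rewrite -(iter_preimage_invariant n fB) in Bx.
  by left.
apply: negligibleU; first exact: enter.
apply: negligible_bigcup => n; apply/negligibleP.
  exact: iter_preimage_measurable.
apply: etrans (probE mu (iter_preimage_measurable mf n mBY)) _.
by rewrite prob_iter_preimage// BY0.
Qed.

(** A set invariant under [f] is invariant under the return map, so it fills [Y] or
    misses it, up to null sets. *)
Lemma ergodic_from_return_map (mu muh : probability T R) :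
  preserves mu f -> {ae mu, forall x, exists n, first_return f Y x n} ->
  0 < prob mu Y ->
  (forall B, measurable B -> prob muh B = prob mu (B `&` Y) / prob mu Y) ->
  (forall B, measurable B -> fh @^-1` B = B -> prob muh B = 0 \/ prob muh B = 1) ->
  ergodic mu f.
Proof.
move=> inv enter Y0 muhE erg B mB fB.
have [|] := erg B mB (return_map_invariant Y fB).
  rewrite muhE// => /eqP; rewrite mulf_eq0 invr_eq0 (gt_eqF Y0) orbF => /eqP BY0.
  by left; exact: invariant_null BY0.
move=> B1; right; have mCB := measurableC mB.
have : prob muh (~` B) = 0 by rewrite prob_setC// B1 subrr.
rewrite muhE// => /eqP; rewrite mulf_eq0 invr_eq0 (gt_eqF Y0) orbF => /eqP BY0.
have : prob mu (~` B) = 0.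
  by apply: invariant_null BY0 => //; rewrite -[in RHS]fB.
by rewrite prob_setC// => /eqP; rewrite subr_eq0 eq_sym => /eqP.
Qed.

End measurable_return_map.

(** * Counting exceedances along orbits *)

Section hits.
Context (T : Type).
Implicit Types (S : T -> T) (U : set T) (p : pred nat).

Definition hits S U p (N : nat) (x : T) : nat :=
  \sum_(i < N) (p i && (iter i S x \in U)).

Lemma hits_widen S U p N M x : (N <= M)%N -> (forall i, p i -> (i < N)%N) ->
  hits S U p M x = hits S U p N x.
Proof.
move=> NM pN; rewrite /hits -(subnKC NM) big_split_ord /=.
rewrite [X in (_ + X)%N]big1 ?addn0//.
by move=> i _; case: (boolP (p _)) => // /pN; rewrite ltnNge leq_addr.
Qed.

Lemma hits_neq S S' U p p' N x x' : hits S U p N x <> hits S' U p' N x' ->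
  exists2 i, (i < N)%N &
    (p i && (iter i S x \in U)) != (p' i && (iter i S' x' \in U)).
Proof.
move=> neq; apply: contra_notP neq => nex; apply: eq_bigr => i _.
congr nat_of_bool; apply/eqP/negPn/negP => h; apply: nex.
by exists i.
Qed.

Lemma hits_shift S U p N j x : hits S U p N (iter j S x) =
  hits S U (fun i => (j <= i)%N && p (i - j)%N) (j + N) x.
Proof.
rewrite /hits big_split_ord /= [X in _ = (X + _)%N]big1 ?add0n.
  by apply: eq_bigr => i _; rewrite leq_addr addKn -iterD addnC.
by move=> i _; rewrite leqNgt ltn_ord.
Qed.

End hits.

(** The [k]-th iterate of the return map is the [k]-th visit, so counting along
    the return map is counting along the orbit with time read off the clock
    [visits]. *)
Lemma hits_return_map (T : Type) (f : T -> T) (Y U : set T) (p : pred nat) N x :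
  Y x -> U `<=` Y ->
  (forall k, p k -> (k < visits f Y N x)%N) ->
  hits (return_map f Y) U p N x = hits f U (fun t => p (visits f Y t x)) N x.
Proof.
move=> Yx UY pN; have VN := visits_le f Y N x.
rewrite (hits_widen _ _ _ VN pN) {pN VN} /hits.
elim: N => [|N IH]; first by rewrite /visits !big_ord0.
rewrite visits_recr big_ord_recr -IH /=.
case: (boolP (iter N f x \in Y)) => [|nY]; last first.
  rewrite addn0 (memNset (A := U)) ?andbF ?addn0// => /UY YN.
  by rewrite mem_set in nY.
rewrite inE => YN; rewrite addn1 big_ord_recr /=.
by rewrite iter_return_map_visits.
Qed.

(** * First-moment bounds for hitting counts *)

Section hitting_counts.
Context (R : realType) (d : measure_display) (T : measurableType d).
Variables (mu : probability T R) (S : T -> T) (U : set T).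
Hypotheses (mS : measurable_fun setT S) (mU : measurable U).
Implicit Type p : pred nat.

Lemma hits_indic p N : (fun x => (hits S U p N x)%:R : R) =
  fun x => \sum_(i < N) ((p i)%:R * \1_(iter i S @^-1` U) x).
Proof.
apply/funext => x; rewrite natr_sum; apply: eq_bigr => i _.
rewrite indicE; have -> : (x \in iter i S @^-1` U) = (iter i S x \in U).
  by apply/idP/idP; rewrite !inE.
by rewrite -natrM mulnb.
Qed.

Lemma measurable_hits p N : measurable_fun setT (fun x => (hits S U p N x)%:R : R).
Proof.
rewrite hits_indic; apply: measurable_sum => i; apply: measurable_funM => //.
by apply: measurable_indic; exact: iter_preimage_measurable.
Qed.

Lemma measurable_hits_le p N k : measurable [set x | (hits S U p N x <= k)%N].
Proof.
rewrite (_ : [set _ | _] = [set x | (hits S U p N x)%:R < k.+1%:R :> R]).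
  by apply: measurable_ltr => //; exact: measurable_hits.
by apply/seteqP; split => x /=; rewrite ltr_nat.
Qed.

Lemma measurable_hits_gt p N k : measurable [set x | (k < hits S U p N x)%N].
Proof.
rewrite (_ : [set _ | _] = ~` [set x | (hits S U p N x <= k)%N]).
  exact/measurableC/measurable_hits_le.
by apply/seteqP; split => x /=; rewrite ltnNge => /negP.
Qed.

Hypothesis inv : preserves mu S.

Lemma mean_hits p N :
  mean mu (fun x => (hits S U p N x)%:R) ((\sum_(i < N) p i)%:R * prob mu U).
Proof.
rewrite natr_sum mulr_suml hits_indic; apply: mean_sum => i; apply: meanZ => //.
rewrite -(prob_iter_preimage mS i inv mU); apply: mean_indic.
exact: iter_preimage_measurable.
Qed.

Lemma hits_markov p N k :
  k.+1%:R * prob mu [set x | (k < hits S U p N x)%N]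
  <= (\sum_(i < N) p i)%:R * prob mu U.
Proof.
apply: (mean_le (meanZ (ler0n R k.+1) (mean_indic mu (measurable_hits_gt p N k)))
                (mean_hits p N)) => x.
rewrite indicE; case: (boolP (x \in _)); last by rewrite mulr0.
by rewrite inE /= mulr1 ler_nat.
Qed.

Lemma prob_hits_gt0 p N :
  prob mu [set x | (0 < hits S U p N x)%N] <= (\sum_(i < N) p i)%:R * prob mu U.
Proof. by have := hits_markov p N 0; rewrite mul1r. Qed.

Lemma prob_hits_le p N k :
  1 - (\sum_(i < N) p i)%:R * prob mu U / k.+1%:R
  <= prob mu [set x | (hits S U p N x <= k)%N].
Proof.
rewrite (_ : [set _ | _] = ~` [set x | (k < hits S U p N x)%N]).
  rewrite prob_setC; last exact: measurable_hits_gt.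
  by rewrite lerB// ler_pdivlMr// mulrC; exact: hits_markov.
apply/seteqP; split => x /=; rewrite ltnNge; last by move/negP; rewrite negbK.
by move=> h; apply/negP; rewrite negbK.
Qed.

End hitting_counts.

Section counting_integers.
Context (R : realType).
Implicit Type p : pred nat.

(** The interval may be empty: [lo - 1 <= hi] only keeps the bound nonnegative. *)
Lemma count_between p N (lo hi : R) : lo - 1 <= hi ->
  (forall i, (i < N)%N -> p i -> lo <= i%:R <= hi) ->
  (\sum_(i < N) p i)%:R <= hi - lo + 1.
Proof.
elim: N hi => [|N IH] hi lohi pN; first by rewrite big_ord0; lra.
rewrite big_ord_recr /= natrD; case: (boolP (p N)) => pN' /=; last first.
  by rewrite addr0; apply: IH => // i iN; apply: pN; exact: leqW.
have /andP[lN Nh] := pN N (ltnSn N) pN'.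
have : (\sum_(i < N) p i)%:R <= (N%:R - 1) - lo + 1.
  apply: IH; first by lra.
  move=> i iN pi; have /andP[-> _] := pN i (leqW iN) pi.
  by rewrite lerBrDr natr1 ler_nat.
lra.
Qed.

Lemma count_has (I : eqType) (cs : seq I) (q : nat -> I -> bool) N (r : R) :
  (forall c, (\sum_(i < N) q i c)%:R <= r) ->
  (\sum_(i < N) has (q i) cs)%:R <= (size cs)%:R * r.
Proof.
move=> qr; elim: cs => [|c cs IH]; first by rewrite mul0r big1.
rewrite [size _]/= -natr1 mulrDl mul1r; apply: le_trans (lerD IH (qr c)).
rewrite -natrD ler_nat -big_split /=; apply: leq_sum => i _.
by case: (q i c); case: has.
Qed.

End counting_integers.

(** * Comparing the two clocks *)

Section windows.
Context (R : realType).
Implicit Types (J : set R) (cs : seq R).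

(** All that is used of a finite union of intervals: membership can only change
    at finitely many points, and the set is bounded. *)
Definition window J cs (b : R) :=
  (forall t, J t -> 0 <= t < b) /\
  (forall t t', t <= t' -> (t \in J) != (t' \in J) ->
     exists2 c, c \in cs & t <= c <= t').

(** Membership of [i] in [v J] for [v > 0]. *)
Definition in_scaled (v : R) J : pred nat := fun i => (i%:R / v) \in J.

Lemma in_scaled_lt v J cs b i : 0 < v -> window J cs b -> in_scaled v J i ->
  i%:R < v * b.
Proof.
move=> v0 [Jb _]; rewrite /in_scaled inE => /Jb/andP[_].
by rewrite ltr_pdivrMr// mulrC.
Qed.

Lemma window_separation J cs b t t' : window J cs b -> (t \in J) != (t' \in J) ->
  exists2 c, c \in cs & `|t - c| <= `|t - t'|.
Proof.
move=> [_ sep] tt'; have [le|/ltW le] := leP t t'.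
  have [c ccs /andP[tc ct']] := sep t t' le tt'; exists c => //.
  by rewrite !ler0_norm ?subr_le0// !opprB; lra.
rewrite eq_sym in tt'; have [c ccs /andP[tc ct']] := sep t' t le tt'.
by exists c => //; rewrite !ger0_norm ?subr_ge0//; lra.
Qed.

End windows.

Lemma exists_nat_above (R : realType) (x : R) : 0 <= x ->
  exists n : nat, x <= n%:R <= x + 1.
Proof.
move=> x0; have /andP[h1 h2] := truncn_itv x0.
by exists (Num.trunc x).+1; rewrite (ltW h2) -natr1 lerD2r h1.
Qed.

Section comparison.
Context (R : realType) (d : measure_display) (T : measurableType d).
Variables (mu muh : probability T R) (f : T -> T) (Y : set T).
Hypotheses (mf : measurable_fun setT f) (mY : measurable Y).
Hypothesis inv : preserves mu f.
Let m := prob mu Y.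
Hypothesis Y0 : 0 < m.
Hypothesis muhE : forall B, measurable B -> prob muh B = prob mu (B `&` Y) / m.
Local Notation fh := (return_map f Y).
Variables (J : set R) (cs : seq R) (b : R).
Hypothesis JW : window J cs b.
Hypothesis b0 : 0 <= b.
Let L := (size cs)%:R : R.

Lemma measure_base_le1 : m <= 1.
Proof. exact: prob_le1. Qed.

Lemma base_prob_dist A B : measurable A -> measurable B ->
  m * `|prob muh A - prob muh B| = `|prob mu (A `&` Y) - prob mu (B `&` Y)|.
Proof.
move=> mA mB; rewrite !muhE// -{1}(gtr0_norm Y0) -normrM; congr `|_|.
by field; rewrite gt_eqF.
Qed.

(** On the clock of the return map, time [t] is read as [visits f Y t x], which is
    close to [m t]. The windows can disagree at [t] only if an end point of the
    window [m v J] separates the two readings. The assumption on [N] makes the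
    return map leave its window before time [N]. *)
Lemma window_mismatch (U : set T) (v eps K : R) N x : U `<=` Y -> 0 < v ->
  0 <= eps -> 0 <= K -> m * v * b + K <= (m - eps) * N%:R ->
  Y x -> ~ deviation mu f Y eps K x ->
  hits f U (in_scaled v J) N x <> hits fh U (in_scaled (m * v) J) N x ->
  (0 < hits f U (fun t : nat =>
     has (fun c => `|t%:R - v * c| <= (eps * N%:R + K) / m)%R cs) N x)%N.
Proof.
move=> UY v0 eps0 K0 NK Yx ndev neq.
have dev t : `|(visits f Y t x)%:R - m * t%:R| <= eps * t%:R + K.
  by rewrite leNgt; apply/negP => h; apply: ndev; exists t.
have mv0 : 0 < m * v by rewrite mulr_gt0.
have absM (z a : R) : 0 < a -> `|z| * a = `|z * a|.
  by move=> a0; rewrite normrM (gtr0_norm a0).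
rewrite (hits_return_map Yx UY) in neq; last first.
  move=> k /(in_scaled_lt mv0 JW) kb; rewrite -(ltr_nat R).
  have := dev N; rewrite ler_norml => /andP[h _].
  apply: lt_le_trans kb _; lra.
have [t tN h] := hits_neq neq.
have tU : iter t f x \in U by move: h; case: (_ \in U) => //; rewrite !andbF.
rewrite tU !andbT in h.
have [c ccs tc] := window_separation JW h.
rewrite /hits (bigD1 (Ordinal tN))//= addn_gt0; apply/orP; left.
rewrite tU andbT lt0b; apply/hasP; exists c => //=.
rewrite -(ler_pM2r mv0) in tc.
rewrite ler_pdivlMr//.
have -> : `|t%:R - v * c| * m = `|t%:R / v - c| * (m * v).
  rewrite !absM//; congr `|_|.
  by field; rewrite gt_eqF.
apply: le_trans tc _.
have -> : `|t%:R / v - (visits f Y t x)%:R / (m * v)| * (m * v) =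
          `|(visits f Y t x)%:R - m * t%:R|.
  rewrite absM// distrC; congr `|_|.
  by field; rewrite !gt_eqF.
apply: le_trans (dev t) _; rewrite lerD2r ler_wpM2l// ler_nat; exact: ltnW.
Qed.

(** Off the deviation set the two counts differ only when the level set is hit near
    an end point of the window; the first moment bounds the probability of that. *)
Lemma prob_clock_comparison (U : set T) (v eps K : R) N kappa : measurable U ->
  U `<=` Y -> 0 < v -> 0 <= eps -> 0 <= K -> m * v * b + K <= (m - eps) * N%:R ->
  m * `|prob muh [set x | (hits f U (in_scaled v J) N x <= kappa)%N] -
   prob muh [set x | (hits fh U (in_scaled (m * v) J) N x <= kappa)%N]|
  <= prob mu (deviation mu f Y eps K) +
     L * (2 * ((eps * N%:R + K) / m) + 1) * prob mu U.
Proof.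
move=> mU UY v0 eps0 K0 NK.
set A := [set x | _]; set B := [set x | _].
have mfh := measurable_return_map mf mY.
have mA : measurable A by exact: measurable_hits_le.
have mB : measurable B by exact: measurable_hits_le.
set r := (eps * N%:R + K) / m.
have r0 : 0 <= r by rewrite divr_ge0 ?(ltW Y0)// addr_ge0// mulr_ge0.
set p := fun t : nat => has (fun c => `|t%:R - v * c| <= r) cs.
pose D := deviation mu f Y eps K.
pose C := [set x | (0 < hits f U p N x)%N].
have mD : measurable D by exact: measurable_deviation.
have mC : measurable C by exact: measurable_hits_gt.
have C_le : prob mu C <= L * (2 * r + 1) * prob mu U.
  apply: le_trans (prob_hits_gt0 mf mU inv p N) _.
  rewrite ler_wpM2r ?prob_ge0//.
  apply: (@count_has _ _ _ (fun (i : nat) c => `|i%:R - v * c| <= r)) => c.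
  have -> : 2 * r + 1 = (v * c + r) - (v * c - r) + 1 by ring.
  apply: (count_between (p := fun i : nat => `|i%:R - v * c| <= r)); first by lra.
  by move=> i _; rewrite ler_distl.
have AB x : Y x -> ~ D x -> ~ C x -> A x <-> B x.
  move=> Yx nD nC; rewrite /A /B /=.
  have [->//|/eqP neq] :=
    eqVneq (hits f U (in_scaled v J) N x) (hits fh U (in_scaled (m * v) J) N x).
  by exfalso; apply: nC; exact: (window_mismatch UY v0 eps0 K0 NK Yx nD neq).
have mAY := measurableI _ _ mA mY; have mBY := measurableI _ _ mB mY.
have mDC := measurableU _ _ mD mC.
have DC : prob mu (D `|` C) <= prob mu D + prob mu C by exact: prob_cover.
have le1 : prob mu (A `&` Y) <= prob mu (B `&` Y) + prob mu (D `|` C).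
  apply: prob_cover => // x [Ax Yx].
  have [|nDC] := pselect ((D `|` C) x); [by right|left; split => //].
  by apply/(AB x Yx) => // h; apply: nDC; [left|right].
have le2 : prob mu (B `&` Y) <= prob mu (A `&` Y) + prob mu (D `|` C).
  apply: prob_cover => // x [Ax Yx].
  have [|nDC] := pselect ((D `|` C) x); [by right|left; split => //].
  by apply/(AB x Yx) => // h; apply: nDC; [left|right].
rewrite base_prob_dist// ler_norml; apply/andP; split; lra.
Qed.

(** The shifted and the original count differ only through hits at the first [j]
    instants or within [j] instants after an end point of the window. *)
Lemma prob_shift (U : set T) (v : R) N j kappa : measurable U -> 0 < v ->
  v * b <= N%:R ->
  let E := [set x | (hits f U (in_scaled v J) N x <= kappa)%N] in
  exists C, [/\ measurable C, prob mu C <= (j%:R + L * j.+1%:R) * prob mu U &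
    forall x, ~ C x -> E (iter j f x) <-> E x].
Proof.
move=> mU v0 vb E.
pose q (i : nat) (c : R) := i%:R - j%:R <= v * c <= i%:R.
pose p (i : nat) := (i < j)%N || has (q i) cs.
exists [set x | (0 < hits f U p (j + N) x)%N]; split.
- exact: measurable_hits_gt.
- apply: le_trans (prob_hits_gt0 mf mU inv p (j + N)) _.
  rewrite ler_wpM2r ?prob_ge0//.
  apply: (@le_trans _ _ ((\sum_(i < j + N) (i < j))%:R +
                         (\sum_(i < j + N) has (q i) cs)%:R)).
    rewrite -natrD ler_nat -big_split /=; apply: leq_sum => i _.
    by rewrite /p; case: (_ < _)%N; case: has.
  apply: lerD.
    rewrite ler_nat big_split_ord /= [X in (_ + X)%N]big1 ?addn0.
      apply: leq_trans (leq_sum _ (fun i _ => leq_b1 _)) _.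
      by rewrite sum1_card card_ord.
    by move=> i _; rewrite ltnNge leq_addr.
  apply: count_has => c.
  have -> : j.+1%:R = (v * c + j%:R) - v * c + 1 :> R by rewrite -natr1; ring.
  apply: (count_between (p := q ^~ c)); first by have := ler0n R j; lra.
  by move=> i _ /andP[h1 h2]; apply/andP; split; lra.
move=> x nC; rewrite /E /=.
have pN i : in_scaled v J i -> (i < N)%N.
  by move=> /(in_scaled_lt v0 JW) h; rewrite -(ltr_nat R); exact: lt_le_trans vb.
rewrite hits_shift -(hits_widen f U x (leq_addl j N) pN).
set h1 := hits _ _ _ _ _; set h2 := hits _ _ _ _ _.
have [->//|/eqP neq] := eqVneq h1 h2; exfalso; apply: nC.
have [i iN h] := hits_neq neq.
have iU : iter i f x \in U by move: h; case: (_ \in U) => //; rewrite !andbF.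
rewrite iU !andbT in h.
rewrite /= /hits (bigD1 (Ordinal iN))//= addn_gt0; apply/orP; left.
rewrite iU andbT lt0b /p; case: leqP h => //= ji h.
have le : (i - j)%N%:R / v <= i%:R / v :> R.
  by rewrite ler_pM2r ?invr_gt0// ler_nat leq_subr.
have [c ccs /andP[c1 c2]] := JW.2 _ _ le h.
apply/hasP; exists c => //; rewrite /q -natrB//.
by move: c1 c2; rewrite ler_pdivrMr// ler_pdivlMr// [c * v]mulrC => -> ->.
Qed.

(** The sum is the integral over [E] of the number of visits to [Y] before [n]. *)
Lemma visits_average E (eps K : R) n : measurable E -> 0 <= eps -> 0 <= K ->
  `|\sum_(j < n) prob mu (E `&` iter j f @^-1` Y) - n%:R * m * prob mu E|
  <= eps * n%:R + K + n%:R * prob mu (deviation mu f Y eps K).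
Proof.
move=> mE eps0 K0; set D := deviation _ _ _ _ _.
have mD : measurable D by exact: measurable_deviation.
have c0 : 0 <= eps * n%:R + K by rewrite addr_ge0// mulr_ge0.
have nm0 : 0 <= n%:R * m by rewrite mulr_ge0// ltW.
have mF (j : 'I_n) : measurable (E `&` iter j f @^-1` Y).
  by apply: measurableI => //; exact: iter_preimage_measurable.
have meanV := mean_sum (index_enum 'I_n) (fun j => mean_indic mu (mF j)).
have meanE := meanZ nm0 (mean_indic mu mE).
have meanC := meanD (mean_cst mu c0) (meanZ (ler0n R n) (mean_indic mu mD)).
have sumE x : \sum_(j < n) \1_(E `&` iter j f @^-1` Y) x =
    \1_E x * (visits f Y n x)%:R :> R.
  rewrite natr_sum mulr_sumr; apply: eq_bigr => j _.
  rewrite !indicE in_setI -natrM mulnb.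
  by rewrite (_ : (x \in iter j f @^-1` Y) = (iter j f x \in Y)).
have key x : `|\1_E x * (visits f Y n x)%:R - n%:R * m * \1_E x|
    <= eps * n%:R + K + n%:R * \1_D x.
  have -> : \1_E x * (visits f Y n x)%:R - n%:R * m * \1_E x =
            \1_E x * ((visits f Y n x)%:R - m * n%:R) by ring.
  have E1 : `|\1_E x * ((visits f Y n x)%:R - m * n%:R)|
         <= `|(visits f Y n x)%:R - m * n%:R|.
    by rewrite normrM ler_piMl// indicE; case: (_ \in _); rewrite ?normr1 ?normr0.
  apply: le_trans E1 _; rewrite indicE; case: (boolP (x \in D)).
    move=> _; rewrite mulr1; apply: (@le_trans _ _ n%:R); last by rewrite lerDr.
    have : (visits f Y n x)%:R <= n%:R :> R by rewrite ler_nat visits_le.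
    have : 0 <= (visits f Y n x)%:R :> R by [].
    have : m * n%:R <= n%:R by rewrite ler_piMl// measure_base_le1.
    have : 0 <= m * n%:R by rewrite mulr_ge0// ltW.
    by rewrite ler_norml; move=> h1 h2 h3 h4; apply/andP; split; lra.
  move=> xD; rewrite mulr0 addr0 leNgt; apply/negP => h.
  by move/negP: xD; apply; rewrite inE; exists n.
rewrite ler_norml; apply/andP; split.
- have : n%:R * m * prob mu E <= \sum_(j < n) prob mu (E `&` iter j f @^-1` Y) +
      (eps * n%:R + K + n%:R * prob mu D).
    apply: (mean_le meanE (meanD meanV meanC)) => x.
    by have := key x; rewrite sumE ler_norml => /andP[]; lra.
  by lra.
- have : \sum_(j < n) prob mu (E `&` iter j f @^-1` Y) <= n%:R * m * prob mu E +
      (eps * n%:R + K + n%:R * prob mu D).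
    apply: (mean_le meanV (meanD meanE meanC)) => x.
    by have := key x; rewrite sumE ler_norml => /andP[]; lra.
  by lra.
Qed.

(** If shifting the orbit hardly affects [E], then up to small errors
    [mu (E `&` Y)] equals [mu (E `&` f^-j Y)] for every [j < n], and the average of
    the latter over [j] is [m mu E] because the time spent in [Y] self-averages. *)
Lemma prob_conditioning E (eps K a : R) n : measurable E ->
  0 <= eps -> 0 <= K -> (0 < n)%N ->
  (forall j, (j < n)%N -> exists C, [/\ measurable C, prob mu C <= a &
     forall x, ~ C x -> E (iter j f x) <-> E x]) ->
  `|prob mu (E `&` Y) - m * prob mu E|
  <= a + eps + K / n%:R + prob mu (deviation mu f Y eps K).
Proof.
move=> mE eps0 K0 n0 shift.
have n0' : 0 < n%:R :> R by rewrite ltr0n.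
have step (j : 'I_n) :
    `|prob mu (E `&` Y) - prob mu (E `&` iter j f @^-1` Y)| <= a.
  have [C [mC Ca EC]] := shift j (ltn_ord j).
  have mEY := measurableI _ _ mE mY.
  rewrite -(prob_iter_preimage mf j inv mEY).
  have m1 := iter_preimage_measurable mf j mEY.
  have m2 := measurableI _ _ mE (iter_preimage_measurable mf j mY).
  rewrite ler_distl; apply/andP; split.
    rewrite lerBlDr.
    apply: (@le_trans _ _ (prob mu (iter j f @^-1` (E `&` Y)) + prob mu C)).
      apply: prob_cover => // x [Ex Yx]; have [|nC] := pselect (C x); first by right.
      by left; split => //; apply/(EC x nC).
    by rewrite lerD2l.
  apply: (@le_trans _ _ (prob mu (E `&` iter j f @^-1` Y) + prob mu C)).
    apply: prob_cover => // x [Ex Yx]; have [|nC] := pselect (C x); first by right.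
    by left; split => //; apply/(EC x nC).
  by rewrite lerD2l.
have sum_step : `|n%:R * prob mu (E `&` Y) -
    \sum_(j < n) prob mu (E `&` iter j f @^-1` Y)| <= n%:R * a.
  have cst (z : R) : n%:R * z = \sum_(j < n) z.
    by rewrite sumr_const card_ord mulr_natl.
  rewrite !cst -sumrB; apply: le_trans (ler_norm_sum _ _ _) _.
  by apply: ler_sum => j _; exact: step.
have avg := visits_average n mE eps0 K0.
rewrite -(ler_pM2l n0') -{1}(gtr0_norm n0') -normrM mulrBr mulrA.
apply: le_trans (ler_distD (\sum_(j < n) prob mu (E `&` iter j f @^-1` Y)) _ _) _.
apply: le_trans (lerD sum_step avg) _.
rewrite !mulrDr [n%:R * (K / n%:R)]mulrCA divff ?gt_eqF// mulr1 [n%:R * eps]mulrC.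
by rewrite !addrA.
Qed.

Lemma hits_window_widen (S : T -> T) (U : set T) v N M x : 0 < v ->
  v * b <= N%:R -> v * b <= M%:R ->
  hits S U (in_scaled v J) N x = hits S U (in_scaled v J) M x.
Proof.
move=> v0; have key N' M' : (N' <= M')%N -> v * b <= N'%:R ->
    hits S U (in_scaled v J) M' x = hits S U (in_scaled v J) N' x.
  move=> NM vN; apply: hits_widen => // i /(in_scaled_lt v0 JW) h.
  by rewrite -(ltr_nat R); exact: lt_le_trans vN.
move=> vN vM; case: (leqP N M) => [le|/ltnW le]; first exact/esym/key.
exact: key.
Qed.

Hypothesis erg : ergodic mu f.

(** Two replacements, each costing little when [mu U] is small: the clock of the
    return map by the clock of [f], by [prob_clock_comparison], and the initial law
    [muh] by [mu], by [prob_conditioning]. *)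
Lemma clock_change (e : R) : 0 < e ->
  exists2 q0 : R, 0 < q0 & forall (U : set T) (v : R) N kappa,
    measurable U -> U `<=` Y -> 0 < prob mu U < q0 -> v = (prob mu U)^-1 ->
    v * b <= N%:R ->
    `|prob mu [set x | (hits f U (in_scaled v J) N x <= kappa)%N] -
      prob muh [set x | (hits fh U (in_scaled (m * v) J) N x <= kappa)%N]| <= e.
Proof.
move=> e0.
have L0 : 0 <= L by rewrite /L.
(* Six errors of size at most [a] are added up; the accuracy [eps] is fixed first,
   then the constant [K] and the averaging time [n] that it requires, and only
   then the bound on [mu U]. *)
pose a := e * m / 8.
have a0 : 0 < a by rewrite divr_gt0// mulr_gt0.
pose eps := Num.min (m / 2) (Num.min a (a * m / (4 * L * b + 1))).
have Lb0 : 0 < 4 * L * b + 1 by rewrite ltr_wpDl// mulr_ge0// mulr_ge0.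
have eps0 : 0 < eps by rewrite !lt_min a0 !divr_gt0// mulr_gt0.
have epsm : eps <= m / 2 by rewrite /eps ge_min lexx.
have epsa : eps <= a by rewrite /eps !ge_min lexx orbT.
have epsb : L * (4 * eps * b) <= a * m.
  have : eps <= a * m / (4 * L * b + 1) by rewrite /eps !ge_min lexx !orbT.
  rewrite ler_pdivlMr// mulrDr mulr1; lra.
have [K K0 dev] := visits_deviation mf mY inv erg eps0 a0.
pose n := (Num.bound (K / a)).+1.
have n0 : 0 < n%:R :> R by rewrite ltr0n.
have Kn : K / n%:R <= a.
  rewrite ler_pdivrMr// mulrC -ler_pdivrMr//; apply: ltW.
  apply: lt_le_trans (archi_boundP _) _; first by rewrite divr_ge0// ltW.
  by rewrite ler_nat.
pose G := L * (2 * ((eps * (2 * K / m + 1) + K) / m) + 1) + (n%:R + L * n.+1%:R).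
have Km0 : 0 <= 2 * K / m + 1 by rewrite addr_ge0// divr_ge0 ?(ltW Y0)// mulr_ge0.
have G0 : 0 <= G.
  apply: addr_ge0; last by rewrite addr_ge0// mulr_ge0.
  rewrite mulr_ge0// addr_ge0// mulr_ge0// divr_ge0 ?(ltW Y0)// addr_ge0//.
  by rewrite mulr_ge0// ltW.
exists (a / (G + 1)); first by rewrite divr_gt0// ltr_wpDl.
move=> U v N kappa mU UY /andP[q0 qlt] vE vN.
have v0 : 0 < v by rewrite vE invr_gt0.
have vq : v * prob mu U = 1 by rewrite vE mulVf// gt_eqF.
have Gq : G * prob mu U <= a.
  move: qlt; rewrite ltr_pdivlMr; last by rewrite ltr_wpDl.
  by have := mulrDr (prob mu U) G 1; have := prob_ge0 mu U; lra.
have bv0 : 0 <= v * b by rewrite mulr_ge0// ltW.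
have Kd0 : 0 <= 2 * K / m by rewrite divr_ge0 ?(ltW Y0)// mulr_ge0.
(* A horizon by which both windows are over, of order [v]. *)
have [t /andP[t1 t2]] : exists t : nat,
    2 * (v * b) + 2 * K / m <= t%:R <= 2 * (v * b) + 2 * K / m + 1.
  by apply: exists_nat_above; lra.
have tm : m * v * b + K <= (m - eps) * t%:R.
  have h1 : m / 2 * (2 * (v * b) + 2 * K / m) <= m / 2 * t%:R.
    by rewrite ler_pM2l// divr_gt0.
  have h2 : m / 2 * t%:R <= (m - eps) * t%:R by rewrite ler_wpM2r//; lra.
  apply: le_trans (le_trans h1 h2); rewrite le_eqVlt; apply/orP; left; apply/eqP.
  by field; rewrite gt_eqF.
have vt : v * b <= t%:R by lra.
have mvb (M : nat) : v * b <= M%:R -> m * v * b <= M%:R.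
  by apply: le_trans; rewrite -mulrA ler_piMl// measure_base_le1.
rewrite (_ : [set x | (hits f U (in_scaled v J) N x <= kappa)%N] =
  [set x | (hits f U (in_scaled v J) t x <= kappa)%N]); last first.
  by apply/seteqP; split => x /=; rewrite (hits_window_widen _ _ _ v0 vN vt).
rewrite (_ : [set x | (hits fh U (in_scaled (m * v) J) N x <= kappa)%N] =
  [set x | (hits fh U (in_scaled (m * v) J) t x <= kappa)%N]); last first.
  apply/seteqP; split => x /=;
    by rewrite (hits_window_widen _ _ _ (mulr_gt0 Y0 v0) (mvb _ vN) (mvb _ vt)).
set E := [set x | _]; set B := [set x | _].
have mE : measurable E by exact: measurable_hits_le.
have clock := prob_clock_comparison kappa mU UY v0 (ltW eps0) K0 tm.
rewrite -/E -/B in clock.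
have shift j : (j < n)%N -> exists C, [/\ measurable C,
    prob mu C <= (n%:R + L * n.+1%:R) * prob mu U &
    forall x, ~ C x -> E (iter j f x) <-> E x].
  move=> jn; have [C [mC Cle CE]] := prob_shift j kappa mU v0 vt.
  exists C; split => //; apply: le_trans Cle _; rewrite ler_wpM2r ?prob_ge0//.
  by rewrite lerD ?ler_nat ?ler_wpM2l ?ler_nat// ltnW.
have cond := prob_conditioning mE (ltW eps0) K0 (ltn0Sn _) shift.
rewrite -(ler_pM2l Y0).
have -> : m * `|prob mu E - prob muh B| =
    `|m * (prob mu E - prob muh E) + m * (prob muh E - prob muh B)|.
  by rewrite -{1}(gtr0_norm Y0) -normrM; congr `|_|; ring.
apply: le_trans (ler_normD _ _) _.
rewrite [X in _ + X]normrM (gtr0_norm Y0).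
have -> : `|m * (prob mu E - prob muh E)| = `|prob mu (E `&` Y) - m * prob mu E|.
  by rewrite distrC mulrBr muhE// mulrCA divff ?gt_eqF// mulr1.
apply: le_trans (lerD cond clock) _.
have tq : t%:R * prob mu U <= 2 * b + (2 * K / m + 1) * prob mu U.
  have : t%:R * prob mu U <= (2 * (v * b) + 2 * K / m + 1) * prob mu U.
    by rewrite ler_wpM2r ?prob_ge0.
  have -> : (2 * (v * b) + 2 * K / m + 1) * prob mu U =
    2 * b * (v * prob mu U) + (2 * K / m + 1) * prob mu U by ring.
  by rewrite vq mulr1.
have Ltq : L * (2 * ((eps * t%:R + K) / m) + 1) * prob mu U <=
    a + L * (2 * ((eps * (2 * K / m + 1) + K) / m) + 1) * prob mu U.
  have -> : L * (2 * ((eps * t%:R + K) / m) + 1) * prob mu U =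
     L * 2 * eps / m * (t%:R * prob mu U) + L * (2 * (K / m) + 1) * prob mu U.
    by field; rewrite gt_eqF.
  have : L * 2 * eps / m * (t%:R * prob mu U) <=
     L * 2 * eps / m * (2 * b + (2 * K / m + 1) * prob mu U).
    by rewrite ler_wpM2l// divr_ge0 ?(ltW Y0)// mulr_ge0 ?(ltW eps0)// mulr_ge0.
  have -> : L * 2 * eps / m * (2 * b + (2 * K / m + 1) * prob mu U) =
     L * (4 * eps * b) / m + L * 2 * eps / m * ((2 * K / m + 1) * prob mu U).
    by field; rewrite gt_eqF.
  have : L * (4 * eps * b) / m <= a by rewrite ler_pdivrMr.
  have -> : L * (2 * ((eps * (2 * K / m + 1) + K) / m) + 1) * prob mu U =
     L * 2 * eps / m * ((2 * K / m + 1) * prob mu U) +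
     L * (2 * (K / m) + 1) * prob mu U.
    by field; rewrite gt_eqF.
  lra.
have em : m * e = 8 * a by rewrite /a; field.
rewrite em; move: Gq; rewrite /G mulrDl => Gq.
have sum (a' eps' x k y w w' : R) : w' + x <= a' -> w <= a' + w' -> y < a' ->
  k <= a' -> eps' <= a' -> 0 < a' -> x + eps' + k + y + (y + w) <= 8 * a' by lra.
exact: sum Gq Ltq dev Kn epsa a0.
Qed.

End comparison.

(** * Distribution functions of exceedance counts *)

Section exceedance_counts.
Context (R : realType) (d : measure_display) (T : measurableType d).
Variables (phi : T -> \bar R) (mphi : measurable_fun setT phi).
Implicit Types (S : T -> T) (A J : set R) (u v : R).

Lemma measurable_exceedance u : measurable (exceedance phi u).
Proof.
by rewrite -[X in measurable X]setTI; exact: measurable_lte.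
Qed.

Lemma exceedance_countE S u A N x : (forall i : nat, A i%:R -> (i < N)%N) ->
  exceedance_count phi S u A x =
  (hits S (exceedance phi u) (fun i => i%:R \in A) N x)%:R%:E.
Proof.
move=> AN; rewrite /exceedance_count esum_mkcond -nneseries_esumT; last first.
  by move=> i; case: ifP => // _; rewrite lee_fin.
rewrite (nneseries_split 0 N); last first.
  by move=> i _; case: ifP => // _; rewrite lee_fin.
rewrite add0n [X in (_ + X)%E]eseries0 ?adde0; last first.
  move=> i Ni _; case: ifPn => //; rewrite inE /= => /AN.
  by rewrite ltnNge Ni.
rewrite big_mkord natr_sum -sumEFin; apply: eq_bigr => i _.
rewrite (_ : (nat_of_ord i \in [set i | A i%:R]) = (i%:R \in A)); last first.
  by apply/idP/idP; rewrite !inE.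
rewrite (_ : (iter i S x \in exceedance phi u) = (u%:E < phi (iter i S x))%E).
  by case: (_ \in A).
by apply/idP/idP; rewrite inE.
Qed.

Lemma count_cdfE (nu : probability T R) S J kappa u N :
  let v := (prob nu (exceedance phi u))^-1 in
  (forall i : nat, scale_set v J i%:R -> (i < N)%N) ->
  count_cdf nu S phi J kappa u = prob nu
    [set x | (hits S (exceedance phi u) (fun i => i%:R \in scale_set v J) N x
              <= kappa)%N].
Proof.
move=> v vN; rewrite /count_cdf -/(prob nu _) -/v; congr fine; congr (nu _).
by apply/seteqP; split => x /=; rewrite (exceedance_countE _ _ _ vN) lee_fin ler_nat.
Qed.

Lemma scale_in_scaled v J : 0 < v ->
  (fun i : nat => i%:R \in scale_set v J) = in_scaled v J.
Proof.
move=> v0; apply/funext => i; rewrite /in_scaled /scale_set.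
apply/idP/idP; rewrite !inE.
  by move=> [t Jt <-]; rewrite mulrAC divff ?gt_eqF// mul1r.
by move=> Jt; exists (i%:R / v) => //; rewrite mulrCA divff ?gt_eqF// mulr1.
Qed.

Lemma scale_set_bound v J cs b t : 0 <= v -> window J cs b -> scale_set v J t ->
  0 <= t <= v * b.
Proof.
move=> v0 [Jb _] [s /Jb/andP[s0 sb] <-].
by rewrite mulr_ge0//= ler_wpM2l// ltW.
Qed.

Lemma count_cdf_in_scaled (nu : probability T R) S J cs b kappa u N :
  let v := (prob nu (exceedance phi u))^-1 in
  0 < v -> window J cs b -> v * b <= N%:R ->
  count_cdf nu S phi J kappa u = prob nu
    [set x | (hits S (exceedance phi u) (in_scaled v J) N x <= kappa)%N].
Proof.
move=> v v0 JW vN; rewrite -scale_in_scaled//; apply: count_cdfE => i h.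
have : in_scaled v J i by rewrite -scale_in_scaled// mem_set.
by move=> /(in_scaled_lt v0 JW) ?; rewrite -(ltr_nat R); exact: lt_le_trans vN.
Qed.

(** The mean count is at most [b + 1] at every level, so Markov's inequality gives
    tightness uniformly in the level. A null level set makes [v] equal to
    [0^-1 = 0], and the bound then says that there is almost surely no hit. *)
Lemma count_cdf_bounds (nu : probability T R) S J cs b kappa u :
  measurable_fun setT S -> preserves nu S -> window J cs b -> 0 <= b ->
  [/\ 1 - (b + 1) / kappa.+1%:R <= count_cdf nu S phi J kappa u,
      0 <= count_cdf nu S phi J kappa u <= 1 &
      prob nu (exceedance phi u) = 0 -> count_cdf nu S phi J kappa u = 1].
Proof.
move=> mS inv JW b0; have mU := measurable_exceedance u.
set q := prob nu (exceedance phi u); have q0 : 0 <= q by exact: prob_ge0.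
have v0 : 0 <= q^-1 by rewrite invr_ge0.
pose N := (Num.bound (q^-1 * b)).+1.
have vN (i : nat) : scale_set q^-1 J i%:R -> (i < N)%N.
  move=> /(scale_set_bound v0 JW)/andP[_ h]; rewrite -(ltr_nat R).
  apply: le_lt_trans h _; apply: lt_trans (archi_boundP _) _.
    by rewrite mulr_ge0.
  by rewrite ltr_nat.
rewrite (count_cdfE _ _ vN) -/q; set A := [set x | _].
have mA : measurable A by exact: measurable_hits_le.
have count : (\sum_(i < N) ((i%:R : R) \in scale_set q^-1 J))%:R <= q^-1 * b + 1 :> R.
  have -> : q^-1 * b + 1 = q^-1 * b - 0 + 1 by rewrite subr0.
  apply: (count_between (p := fun i => i%:R \in scale_set q^-1 J)).
    by rewrite add0r (le_trans (lerN10 _))// mulr_ge0.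
  by move=> i _; rewrite inE => /(scale_set_bound v0 JW).
have low := prob_hits_le mS mU inv (fun i => i%:R \in scale_set q^-1 J) N kappa.
rewrite -/A -/q in low.
split.
- apply: le_trans low; rewrite lerB// ler_wpM2r ?invr_ge0//.
  apply: le_trans (ler_wpM2r q0 count) _; rewrite mulrDl mul1r lerD ?prob_le1//.
  rewrite mulrAC; have [->|qn0] := eqVneq q 0; first by rewrite mulr0 mul0r.
  by rewrite mulVf// mul1r.
- by rewrite prob_ge0 prob_le1.
- move=> q_eq0; apply/eqP; rewrite eq_le prob_le1//=.
  by move: low; rewrite q_eq0 mulr0 mul0r subr0.
Qed.

(** Only the instants [0] and [1] can lie in the window, so the count is at most [2],
    and then [P (count <= 0) + P (count <= 1)] is [2] minus the mean count. *)
Lemma count_cdf_two_instants (nu : probability T R) S u (c : R) :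
  measurable_fun setT S -> preserves nu S ->
  let q := prob nu (exceedance phi u) in
  0 < q -> 0 < c <= 2 * q ->
  count_cdf nu S phi `[0, c[ 0 u + count_cdf nu S phi `[0, c[ 1 u =
  2 - (if q < c then 2 else 1) * q.
Proof.
move=> mS inv q q0 /andP[c0 c2]; have mU := measurable_exceedance u.
have v0 : 0 < q^-1 by rewrite invr_gt0.
pose p (i : nat) := i%:R \in scale_set q^-1 `[0, c[%classic.
have pE i : p i = (i%:R * q < c).
  rewrite /p (_ : (i%:R \in _) = in_scaled q^-1 `[0, c[%classic i).
    rewrite /in_scaled invrK; apply/idP/idP; rewrite inE /= in_itv /=.
      by move=> /andP[].
    by move=> ->; rewrite mulr_ge0// ltW.
  exact: (congr1 (fun g => g i) (scale_in_scaled _ v0)).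
have pN (i : nat) : scale_set q^-1 `[0, c[%classic i%:R -> (i < 2)%N.
  move=> h; have : p i by rewrite /p mem_set.
  rewrite pE => iq; rewrite ltnNge; apply/negP => i2.
  have : 2 * q <= i%:R * q by rewrite ler_pM2r// (ler_nat _ 2).
  by move: iq c2; lra.
rewrite !(count_cdfE _ _ pN) -/q -/p.
have mh k : measurable [set x | (hits S (exceedance phi u) p 2 x <= k)%N].
  exact: measurable_hits_le.
have lhs := meanD (meanD (mean_indic nu (mh 0%N)) (mean_indic nu (mh 1%N)))
  (mean_hits mS mU inv p 2).
have rhs := mean_cst nu (ler0n R 2).
have E x : \1_[set x | (hits S (exceedance phi u) p 2 x <= 0)%N] x +
    \1_[set x | (hits S (exceedance phi u) p 2 x <= 1)%N] x +
    (hits S (exceedance phi u) p 2 x)%:R = 2 :> R.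
  have : (hits S (exceedance phi u) p 2 x <= 2)%N.
    rewrite /hits !big_ord_recl big_ord0 addn0 -[2%N]/(1 + 1)%N.
    by apply: leq_add; exact: leq_b1.
  rewrite !indicE; set h := hits _ _ _ _ _; move=> h2.
  have memE k :
      (x \in [set x | (hits S (exceedance phi u) p 2 x <= k)%N]) = (h <= k)%N.
    by apply/idP/idP; rewrite inE.
  by rewrite !memE; case: h h2 {memE} => [|[|[|]]] //= _; rewrite ?addr0 ?add0r.
have -> : (if q < c then 2 else 1) = (\sum_(i < 2) p i)%:R :> R.
  by rewrite !big_ord_recl big_ord0 /= !pE mul0r c0 mul1r addn0; case: ifP.
set a := prob nu _ + _; suff : a + (\sum_(i < 2) p i)%:R * q = 2 by lra.
apply/eqP; rewrite eq_le; apply/andP; split.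
  by apply: (mean_le lhs rhs) => x; rewrite E.
by apply: (mean_le rhs lhs) => x; rewrite E.
Qed.

End exceedance_counts.

(** * Limits at the maximal level *)

Section levels.
Context (R : realType).
Implicit Types (uF : \bar R) (l : R) (F : R -> R) (A B : set R).

Lemma belowI uF A B : below uF A -> below uF B -> below uF (A `&` B).
Proof.
move=> [a [a1 aA]] [b [b1 bB]]; exists (Num.max a b); split.
  by case: (leP a b).
by move=> u; rewrite gt_max => /andP[au bu] uu; split; [exact: aA|exact: bB].
Qed.

Lemma belowS uF A B : A `<=` B -> below uF A -> below uF B.
Proof. by move=> AB [a [a1 aA]]; exists a; split => // u au uu; exact/AB/aA. Qed.

Lemma below_ex uF A : below uF A -> exists2 u, A u & (u%:E < uF)%E.
Proof.
move=> [a [aF aA]]; case: uF aF aA => [r||] // aF aA; last first.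
  by exists (a + 1); [apply: aA; rewrite ?ltry// ltrDl|rewrite ltry].
rewrite lte_fin in aF.
have h : (((a + r) / 2)%:E < r%:E)%E by rewrite lte_fin midf_lt.
by exists ((a + r) / 2) => //; apply: aA => //; rewrite midf_lt.
Qed.

Lemma below_cvgP uF F l : F @ below uF --> l <->
  forall e, 0 < e -> below uF [set u | `|F u - l| < e].
Proof.
split.
  move=> Fl e e0; have := Fl (ball l e) (nbhsx_ballx l e e0).
  by apply: belowS => u; rewrite /= /ball /= distrC.
move=> Fl A /nbhs_ballP[e /= e0 eA]; have := Fl e e0; apply: belowS => u /= h.
by apply: eA; rewrite /ball /= distrC.
Qed.

(** Any positive function decreasing to [0] at [uF] would do. *)
Definition gauge uF (u : R) : R :=
  match uF with r%:E => r - u | _ => expR (- u) end.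

Lemma gauge_gt0 uF u : (u%:E < uF)%E -> 0 < gauge uF u.
Proof. by case: uF => [r||] //= h; [rewrite subr_gt0 -lte_fin|exact: expR_gt0]. Qed.

Lemma gauge_nonincreasing uF u u' : u <= u' -> gauge uF u' <= gauge uF u.
Proof. by case: uF => [r||] uu' /=; rewrite ?lerD2l ?ler_expR lerN2. Qed.

Lemma gauge_cvg uF e : uF != -oo%E -> 0 < e -> below uF [set u | gauge uF u < e].
Proof.
case: uF => [r||]// _ e0.
  exists (r - e); split; first by rewrite lte_fin ltrBlDr ltrDl.
  by move=> u /= h _; lra.
exists (- ln e); split; first by rewrite ltry.
by move=> u /= h _; rewrite -[ltRHS]lnK ?posrE// ltr_expR; lra.
Qed.

(** The supremum of the errors at higher levels is monotone and still vanishes in the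
    limit; adding [gauge] makes it positive and the bound strict. *)
Lemma monotone_error_bound uF (err : R -> nat -> R) (B : R) : uF != -oo%E ->
  (forall u k, (u%:E < uF)%E -> 0 <= err u k <= B) ->
  (forall e, 0 < e -> below uF [set u | forall k, err u k <= e]) ->
  exists delta : R -> R,
    [/\ (forall u, (u%:E < uF)%E -> 0 < delta u),
        (forall u u', u <= u' -> (u'%:E < uF)%E -> delta u' <= delta u),
        delta @ below uF --> (0 : R) &
        forall u k, (u%:E < uF)%E -> err u k < delta u].
Proof.
move=> uFNy errB err0.
pose E u := [set z | exists u' k, [/\ u <= u', (u'%:E < uF)%E & z = err u' k]].
have Esup u : (u%:E < uF)%E -> has_sup (E u).
  move=> uu; split; first by exists (err u 0%N); exists u, 0%N.
  by exists B => _ [u' [k [_ uu' ->]]]; have /andP[] := errB u' k uu'.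
have err_le u k : (u%:E < uF)%E -> err u k <= sup (E u).
  by move=> uu; apply: ub_le_sup; [exact: (Esup u uu).2|exists u, k].
have sup0 u : (u%:E < uF)%E -> 0 <= sup (E u).
  move=> uu; apply: le_trans (err_le u 0%N uu).
  by have /andP[] := errB u 0%N uu.
exists (fun u => sup (E u) + gauge uF u); split.
- by move=> u uu; rewrite ltr_wpDl ?gauge_gt0// sup0.
- move=> u u' uu' u'F; apply: lerD; last exact: gauge_nonincreasing.
  have uF' : (u%:E < uF)%E by apply: le_lt_trans u'F; rewrite lee_fin.
  apply: ge_sup; first exact: (Esup u' u'F).1.
  move=> _ [w [k [u'w wF ->]]]; apply: ub_le_sup; first exact: (Esup u uF').2.
  by exists w, k; split => //; exact: le_trans u'w.
- apply/below_cvgP => e e0; have e2 : 0 < e / 2 by lra.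
  have [a [aF aerr]] := err0 _ e2; have [b [bF bg]] := gauge_cvg uFNy e2.
  exists (Num.max a b); split; first by case: (leP a b).
  move=> u; rewrite gt_max => /andP[au bu] uu /=.
  rewrite subr0 ger0_norm; last by rewrite addr_ge0 ?sup0// ltW// gauge_gt0.
  rewrite [e]splitr; apply: ler_ltD (bg u bu uu).
  apply: ge_sup; first exact: (Esup u uu).1.
  by move=> _ [w [k [uw wF ->]]]; apply: (aerr w) => //; exact: lt_le_trans uw.
- move=> u k uu; apply: le_lt_trans (err_le u k uu) _.
  by rewrite ltrDl gauge_gt0.
Qed.

End levels.

(** * Transfer of the limit law *)

Lemma ring_window (R : realType) (J : set R) : ring_R J ->
  exists cs b, window J cs b /\ 0 <= b.
Proof.
move=> [s [s0 ->]].
exists (flatten [seq [:: ab.1; ab.2] | ab <- s]), (\sum_(ab <- s) `|ab.2|).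
split; last by apply: sumr_ge0.
have mem (ab : R * R) c : ab \in s -> c = ab.1 \/ c = ab.2 ->
    c \in flatten [seq [:: ab.1; ab.2] | ab <- s].
  move=> abs cab; apply/flatten_mapP; exists ab => //; rewrite !inE.
  by case: cab => ->; rewrite eqxx ?orbT.
split.
  move=> t [ab abs /andP[at_ tb]]; rewrite (le_trans (s0 _ abs) at_)/=.
  apply: lt_le_trans tb _; rewrite (big_rem ab)//=.
  by rewrite (le_trans (ler_norm _))// lerDl sumr_ge0.
move=> t t' tt'; set J' := [set _ | _].
case: (boolP (t \in J')) => [|tJ]; rewrite ?inE.
  move=> [ab abs /andP[at_ tb]]; case: (boolP (t' \in J')) => // t'J _.
  exists ab.2; first exact: mem (or_intror erefl).
  rewrite (ltW tb) /= leNgt; apply/negP => t'b; move/negP: t'J; apply.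
  by rewrite inE; exists ab => //; rewrite (le_trans at_ tt').
case: (boolP (t' \in J')) => //; rewrite inE => -[ab abs /andP[at_ tb]] _.
exists ab.1; first exact: mem (or_introl erefl).
rewrite at_ andbT leNgt; apply/negP => ta; move/negP: tJ; apply.
by rewrite inE; exists ab => //; rewrite (ltW ta) (le_lt_trans tt' tb).
Qed.

Lemma invariant_prob_preserves (R : realType) (d : measure_display)
    (T : measurableType d) (D : set T) (S : T -> T) (nu : probability T R) :
  measurable D -> measurable_fun setT S -> invariant_prob D S nu -> preserves nu S.
Proof.
move=> mD mS [nuD inv] B mB; have mSB := preimage_measurable mS mB.
have mDS := measurableI _ _ mD mSB.
apply: etrans (probE nu mSB) _; rewrite -(inv B mB).
apply: etrans _ (esym (probE nu mDS)); congr EFin.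
rewrite (prob_setID nu mSB mD) [X in _ + X](_ : _ = 0) ?addr0 1?[D `&` _]setIC//.
have : prob nu (S @^-1` B `&` ~` D) <= prob nu (~` D).
  apply: prob_mono; [|exact: measurableC|exact: subIsetr].
  by apply: measurableI => //; exact: measurableC.
have -> : prob nu (~` D) = 0 by rewrite prob_setC// /prob nuD /= subrr.
by move=> h; apply/eqP; rewrite eq_le h prob_ge0.
Qed.

Section transfer.
Context (R : realType) (d : measure_display) (T : measurableType d).
Variables (mu muh : probability T R) (f : T -> T) (Y : set T).
Hypotheses (mf : measurable_fun setT f) (mY : measurable Y).
Hypothesis inv : preserves mu f.
Hypothesis Y0 : 0 < prob mu Y.
Hypothesis muhE : forall B, measurable B ->
  prob muh B = prob mu (B `&` Y) / prob mu Y.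
Local Notation fh := (return_map f Y).
Hypothesis invh : preserves muh fh.
Hypothesis erg : ergodic mu f.
Variables (phi : T -> \bar R) (uF : \bar R).
Hypothesis mphi : measurable_fun setT phi.
Hypothesis U_sub : below uF [set u | exceedance phi u `<=` Y].
Variable Hh : set R -> nat -> R.
Hypothesis Hh_lim : forall J kappa, interval_S J ->
  count_cdf muh fh phi J kappa @ below uF --> Hh J kappa.
Hypothesis Hh_cont : forall J kappa, interval_S J ->
  Hh (scale_set (1 + e) J) kappa @[e --> 0^'+] --> Hh J kappa.

Let mfh : measurable_fun setT fh := measurable_return_map mf mY.

Lemma prob_exceedance_mono (nu : probability T R) u u' : u <= u' ->
  prob nu (exceedance phi u') <= prob nu (exceedance phi u).
Proof.
move=> uu'; apply: prob_mono; try exact: measurable_exceedance.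
by move=> x; rewrite /exceedance /= => h; apply: le_lt_trans h; rewrite lee_fin.
Qed.

(** Otherwise the measures of the level sets decrease to some [c > 0] and time stays
    discrete in the limit: the window of length [c] contains one instant, a slightly
    longer one contains two, and [Hh 0 + Hh 1] jumps from [2 - c] to [2 - 2 c],
    against the continuity of [Hh]. *)
Lemma exceedance_prob_cvg0 (e : R) : 0 < e ->
  below uF [set u | prob muh (exceedance phi u) < e].
Proof.
move=> e0; pose q u := prob muh (exceedance phi u).
have [[u1 u1F qu1]|nex] := pselect (exists2 u, (u%:E < uF)%E & q u < e).
  exists u1; split => // u u1u _ /=.
  by apply: le_lt_trans (prob_exceedance_mono _ (ltW u1u)) qu1.
exfalso; have qe u : (u%:E < uF)%E -> e <= q u.
  by move=> uu; rewrite leNgt; apply/negP => h; apply: nex; exists u.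
pose Q := [set q u | u in [set u | (u%:E < uF)%E]].
have [w _ wF] := below_ex U_sub.
have Qinf : has_inf Q.
  by split; [exists (q w), w|exists e => _ [u uu <-]; exact: qe].
pose c := inf Q.
have c0 : 0 < c.
  apply: lt_le_trans e0 _; apply: lb_le_inf; first exact: Qinf.1.
  by move=> _ [u uu <-]; exact: qe.
have cq u : (u%:E < uF)%E -> c <= q u.
  by move=> uu; apply: ge_inf; [exact: Qinf.2|exists u].
have qc a : 0 < a -> below uF [set u | c <= q u < c + a].
  move=> a0; have [_ [u1 u1F <-] h] := inf_adherent a0 Qinf.
  exists u1; split => // u u1u uu /=; rewrite cq//=.
  exact: le_lt_trans (prob_exceedance_mono _ (ltW u1u)) h.
have J0 : interval_S `[0, c[%classic by exists 0, c.
have a0 : 0 < c / 16 by lra.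
(* A dilation just above 1 at which [Hh] is nearly unchanged. *)
have [t [t0 t1 H0 H1]] : exists t : R, [/\ 0 < t, t < 1,
    `|Hh `[0, c[ 0 - Hh (scale_set (1 + t) `[0, c[) 0| < c / 16 &
    `|Hh `[0, c[ 1 - Hh (scale_set (1 + t) `[0, c[) 1| < c / 16].
  have /cvgrPdist_lt/(_ _ a0) c00 := @Hh_cont _ 0%N J0.
  have /cvgrPdist_lt/(_ _ a0) c01 := @Hh_cont _ 1%N J0.
  near (0 : R)^'+ => t; exists t; split => //.
  - by near: t; exact: c00.
  - by near: t; exact: c01.
have scaleE : scale_set (1 + t) `[0, c[%classic = `[0, (1 + t) * c[%classic.
  have t10 : 0 < 1 + t by lra.
  apply/seteqP; split => z /=; rewrite /scale_set /= !in_itv /=.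
    move=> [s]; rewrite in_itv /= => /andP[s0 sc] <-.
    by rewrite mulr_ge0 ?ltr_pM2l ?(ltW t10).
  move=> /andP[z0 zc]; exists (z / (1 + t)).
    by rewrite in_itv /= divr_ge0 ?(ltW t10)//= ltr_pdivrMr// mulrC.
  by rewrite mulrCA divff ?gt_eqF// mulr1.
rewrite scaleE in H0 H1.
have J1 : interval_S `[0, (1 + t) * c[%classic by exists 0, ((1 + t) * c).
have near_lim J k : interval_S J ->
    below uF [set u | `|count_cdf muh fh phi J k u - Hh J k| < c / 16].
  by move=> JS; have /below_cvgP := @Hh_lim J k JS; apply.
have tc0 : 0 < t * c by rewrite mulr_gt0.
have aa0 : 0 < Num.min (c / 16) (t * c) by rewrite lt_min a0.
have [u [[[[n1 n2] n3] n4] /andP[cu]]] := below_ex (belowI (belowI (belowI (belowI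
  (near_lim _ 0%N J0) (near_lim _ 1%N J0)) (near_lim _ 0%N J1)) (near_lim _ 1%N J1))
  (qc _ aa0)).
rewrite -ltrBlDl lt_min => /andP[uc1 uc2] uu.
have qu0 : 0 < q u by exact: lt_le_trans cu.
have S1 : count_cdf muh fh phi `[0, c[ 0 u +
    count_cdf muh fh phi `[0, c[ 1 u = 2 - q u.
  rewrite count_cdf_two_instants//; last by rewrite c0 /=; rewrite -/(q u); lra.
  by rewrite -/(q u) ltNge cu mul1r.
have S2 : count_cdf muh fh phi `[0, (1 + t) * c[ 0 u +
    count_cdf muh fh phi `[0, (1 + t) * c[ 1 u = 2 - 2 * q u.
  have tc1 : t * c < c by rewrite -[ltRHS]mul1r ltr_pM2r.
  rewrite count_cdf_two_instants//; last first.
    by rewrite -/(q u); apply/andP; split; lra.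
  by rewrite -/(q u); case: ltP => //; lra.
move: n1 n2 n3 n4 H0 H1 S1 S2 => /=; rewrite !ltr_norml.
do 6 (move=> /andP[? ?]); lra.
Unshelve. all: end_near. Qed.

Variables (J : set R) (cs : seq R) (b : R).
Hypotheses (JW : window J cs b) (b0 : 0 <= b).
Hypothesis HhJ_lim : forall kappa,
  count_cdf muh fh phi J kappa @ below uF --> Hh J kappa.

Lemma count_cdf_transfer (e : R) : 0 < e -> below uF [set u | forall kappa,
  `|count_cdf mu f phi J kappa u - count_cdf muh fh phi J kappa u| <= e].
Proof.
move=> e0; have [q0 q00 clock] := clock_change mf mY inv Y0 muhE JW b0 erg e0.
have small := exceedance_prob_cvg0 (divr_gt0 q00 Y0).
apply: belowS (belowI U_sub small) => u [/= UY qu] kappa.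
have mU := measurable_exceedance mphi u.
have qhE : prob muh (exceedance phi u) = prob mu (exceedance phi u) / prob mu Y.
  by rewrite muhE// (setIidl UY).
have [_ _ B1] := count_cdf_bounds mphi kappa u mf inv JW b0.
have [_ _ B2] := count_cdf_bounds mphi kappa u mfh invh JW b0.
(* Both distribution functions are identically 1 at a null level set. *)
have [qz|qnz] := eqVneq (prob mu (exceedance phi u)) 0.
  by rewrite B1// B2 ?qhE ?qz ?mul0r// subrr normr0 ltW.
have qpos : 0 < prob mu (exceedance phi u) by rewrite lt_neqAle eq_sym qnz prob_ge0.
pose v := (prob mu (exceedance phi u))^-1.
have v0 : 0 < v by rewrite invr_gt0.
have vhE : (prob muh (exceedance phi u))^-1 = prob mu Y * v.
  by rewrite qhE invf_div.
have vb0 : 0 <= v * b by rewrite mulr_ge0// ltW.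
pose N := Num.bound (v * b).
have vN : v * b <= N%:R by rewrite ltW// archi_boundP.
rewrite (@count_cdf_in_scaled _ _ _ phi mu f J cs b kappa u N v0 JW vN).
rewrite (@count_cdf_in_scaled _ _ _ phi muh fh J cs b kappa u N) ?vhE//.
- apply: clock => //; rewrite qpos /=.
  by move: qu; rewrite qhE ltr_pM2r ?invr_gt0.
- by rewrite mulr_gt0.
- by apply: le_trans vN; rewrite -mulrA ler_piMl// prob_le1.
Qed.

Lemma Hh_bounds kappa : 1 - (b + 1) / kappa.+1%:R <= Hh J kappa /\
  0 <= Hh J kappa <= 1.
Proof.
have lim (e : R) : 0 < e ->
    exists u, `|count_cdf muh fh phi J kappa u - Hh J kappa| < e.
  move=> e0; have /below_cvgP/(_ e e0)/below_ex[u h _] := @HhJ_lim kappa.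
  by exists u.
have bnd u := count_cdf_bounds mphi kappa u mfh invh JW b0.
move: ((b + 1) / _) bnd => z bnd.
split; [|apply/andP; split]; apply/ler_addgt0Pr => e e0; have [u] := lim e e0;
  have [B1 /andP[B2 B3] _] := bnd u; rewrite ltr_norml => /andP[]; lra.
Qed.

(** For large [kappa] both distribution functions are close to [1], by tightness;
    finitely many values of [kappa] remain. *)
Lemma count_cdf_uniform_cvg (e : R) : 0 < e -> below uF [set u | forall kappa,
  `|count_cdf mu f phi J kappa u - Hh J kappa| <= e].
Proof.
move=> e0; have e2 : 0 < e / 2 by lra.
have bn0 : 0 <= (b + 1) / e by rewrite divr_ge0 ?ltW// ltr_wpDl.
pose k0 := Num.bound ((b + 1) / e).
have large k : (k0 <= k)%N -> (b + 1) / k.+1%:R <= e.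
  move=> k0k; rewrite ler_pdivrMr ?ltr0n// mulrC -ler_pdivrMr//; apply: ltW.
  by apply: lt_le_trans (archi_boundP bn0) _; rewrite ler_nat ltnW.
have few : below uF [set u | forall k, (k < k0)%N ->
    `|count_cdf muh fh phi J k u - Hh J k| <= e / 2].
  elim: k0 {large} => [|k IH].
    by have := U_sub; apply: belowS => u _ k.
  have /below_cvgP/(_ _ e2) := @HhJ_lim k => Hk.
  apply: belowS (belowI IH Hk) => u [/= h1 h2] k'; rewrite ltnS leq_eqVlt.
  by move=> /predU1P[->|/h1//]; exact: ltW.
apply: belowS (belowI few (count_cdf_transfer e2)) => u [/= h1 h2] k.
have [kk0|k0k] := ltnP k k0.
  rewrite [e]splitr; apply: le_trans (ler_distD (count_cdf muh fh phi J k u) _ _) _.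
  by rewrite lerD// h1.
have := large k k0k.
have [B1 /andP[_ B2] _] := count_cdf_bounds mphi k u mf inv JW b0.
have [H1 /andP[_ H2]] := Hh_bounds k.
move: ((b + 1) / _) B1 H1 => z B1 H1 ze.
by rewrite ler_norml; apply/andP; split; lra.
Qed.

End transfer.

(** * From the return map to the original dynamics *)

Theorem theorem5 (R : realType) (d : nat) (X : ptopologicalType)
    (M : riemannian_manifold R d X)
    (f : borel X -> borel X) (mf : measurable_fun [set: borel X] f)
    (mu : probability (borel X) R)
    (mu_inv : invariant_prob [set: borel X] f mu)
    (phi : borel X -> \bar R) (mphi : measurable_fun [set: borel X] phi)
    (zeta : X) (p : nat)
    (phi_max : forall x, (phi x <= phi zeta)%E)
    (zeta_per : prime_period f p zeta)
    (Xh : set (borel X)) (mXh : measurable Xh) (Xh_zeta : Xh zeta)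
    (Xh_pos : (0 < mu Xh)%E)
    (* The first return (entrance) time to Xh is defined almost everywhere. *)
    (Xh_enter : {ae mu, forall x, exists n, first_return f Xh x n})
    (Xh_return : first_return f Xh zeta p)
    (muh : probability (borel X) R)
    (muhE : forall B : set (borel X), measurable B ->
       muh B = (fine (mu (B `&` Xh)) / fine (mu Xh))%:E)
    (pot : borel X -> R) (mpot : measurable_fun [set: borel X] pot)
    (M1 : condition_M1 f Xh pot)
    (M2 : condition_M2 f Xh pot muh)
    (S1 : condition_S1 d f Xh phi zeta)
    (S2 : condition_S2 M f Xh zeta pot)
    (Hh : set R -> nat -> R)
    (Hh_lim : forall J kappa, interval_S J ->
       count_cdf muh (return_map f Xh) phi J kappa @ below (phi zeta)
         --> Hh J kappa)
    (Hh_cdf : forall J, interval_S J -> integer_rv_cdf (Hh J))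
    (Hh_cont : forall J kappa, interval_S J ->
       Hh (scale_set (1 + e) J) kappa @[e --> 0^'+] --> Hh J kappa /\
       Hh (scale_set (1 - e) J) kappa @[e --> 0^'+] --> Hh J kappa)
    (J : set R) (J_ring : ring_R J)
    (* On J the function Hh is again the limit defining it on intervals. *)
    (HhJ_lim : forall kappa,
       count_cdf muh (return_map f Xh) phi J kappa @ below (phi zeta)
         --> Hh J kappa) :
  exists delta : R -> R,
    [/\ (forall u, (u%:E < phi zeta)%E -> 0 < delta u),
        (forall u u', u <= u' -> (u'%:E < phi zeta)%E -> delta u' <= delta u),
        delta @ below (phi zeta) --> 0 &
        forall u kappa, (u%:E < phi zeta)%E ->
          `|count_cdf mu f phi J kappa u - Hh J kappa| < delta u].
Proof.
(* Whatever [eps0] is, the level sets above the resulting [u0] lie in [Xh]. *)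
have half : 0 < (2^-1 : R) < 1 by rewrite invr_gt0 invf_lt1// ltr0n /= ltr1n.
have [u0 [u0F _ S1u]] := S1 _ half.
have U_sub : below (phi zeta) [set u | exceedance phi u `<=` Xh].
  by exists u0; split => // u u0u uu; have [] := S1u u u0u uu.
have uFNy : phi zeta != -oo%E by apply: contraTneq u0F => ->.
have inv : preserves mu f.
  by move=> B mB; have [_ /(_ B mB)] := mu_inv; rewrite setTI.
have Y0 : 0 < prob mu Xh by rewrite -lte_fin -probE.
have muhP B : measurable B -> prob muh B = prob mu (B `&` Xh) / prob mu Xh.
  by move=> mB; rewrite /prob muhE.
have mfh := measurable_return_map mf mXh.
have mD := measurable_returning mf mXh.
have [eqst _] := M2.
have invh : preserves muh (return_map f Xh).
  by case: eqst => -[[/(invariant_prob_preserves mD mfh)]].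
have erg : ergodic mu f.
  apply: (ergodic_from_return_map mf mXh inv Xh_enter Y0 muhP) => B mB fB.
  apply: (equilibrium_ergodic mD mfh _ M1 eqst mB fB).
  exact: measurable_induced_potential.
have [cs [b [JW b0]]] := ring_window J_ring.
have Hh_contr J' kappa : interval_S J' ->
    Hh (scale_set (1 + e) J') kappa @[e --> 0^'+] --> Hh J' kappa.
  by move=> J'S; have [] := Hh_cont J' kappa J'S.
have conv := count_cdf_uniform_cvg mf mXh inv Y0 muhP invh erg mphi U_sub
  Hh_lim Hh_contr JW b0 HhJ_lim.
have HhB kappa : 0 <= Hh J kappa <= 1.
  by have [] := Hh_bounds mf mXh invh mphi JW b0 HhJ_lim kappa.
apply: (@monotone_error_bound _ _
  (fun u kappa => `|count_cdf mu f phi J kappa u - Hh J kappa|) 1) => // u kappa _.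
rewrite normr_ge0 /=.
have [_ /andP[B1 B2] _] := count_cdf_bounds mphi kappa u mf inv JW b0.
have /andP[H1 H2] := HhB kappa.
by rewrite ler_norml; apply/andP; split; lra.
Qed.
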